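(* Let $\sigma:\mathbb R^r\to\mathbb R$ be a fixed (independent of the dimension $d$) ReLU network of arbitrary depth, with biases, such that the law of $(Z,\sigma(Z))$, $Z\sim N(0,I_r)$, has intrinsic dimension $r$. Then there exist a constant $C(\sigma)$ and an absolute constant $c>0$ such that for every $d\ge r$, every $\epsilon\in(0,1]$ and every $n\ge C(\sigma)\,d/\epsilon^2$ there is an estimator $\hat S$, a function of $n$ i.i.d. samples $(x_i,y_i)$ with values in the $r$-dimensional subspaces of $\mathbb R^d$, such that for every $W_\star\in\mathbb R^{d\times r}$ with orthonormal columns, if $x_i\sim N(0,I_d)$ and $y_i=\sigma(W_\star^\top x_i)$, then $\hat S$ recovers $\mathrm{span}[W_\star]$ up to precision $\epsilon$, i.e. $\mathsf d(\hat S,\mathrm{span}[W_\star])\le\epsilon$, with probability at least $1-\exp(-d^c)$.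
   Context: For subspaces $T,T'$ of $\mathbb R^d$, $\mathsf d(T,T')=\|\Pi_T-\Pi_{T'}\|_{\mathrm{op}}$, where $\Pi_T$ is the orthogonal projection onto $T$. A ReLU network with biases is a finite composition of affine maps and coordinatewise applications of $t\mapsto\max(t,0)$, with scalar output. Intrinsic dimension $r$ means: there is no proper subspace $S\subsetneq\mathbb R^r$ such that, for $Z\sim N(0,I_r)$, the projection $Z_{S^\perp}$ is independent of $(Z_S,\sigma(Z))$, where $Z_S$ is the orthogonal projection of $Z$ onto $S$. *)

(* Defs.v *)
(* Library: MathComp and MathComp-Analysis. *)
From HB Require Import structures.
From mathcomp Require Import all_boot all_order all_algebra.
From mathcomp Require Import all_classical all_reals all_analysis.

Set Implicit Arguments.
Unset Strict Implicit.
Unset Printing Implicit Defensive.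

Import Order.TTheory GRing.Theory Num.Theory.
Import numFieldNormedType.Exports.

Local Open Scope classical_set_scope.
Local Open Scope ring_scope.

Section tuple_cons.
Context d (T : measurableType d) (n : nat).

Definition tuple_cons (p : T * n.-tuple T) : n.+1.-tuple T :=
  [tuple of p.1 :: p.2].

Lemma measurable_tuple_cons : measurable_fun setT tuple_cons.
Proof. exact: measurable_cons. Qed.

HB.instance Definition _ :=
  isMeasurableFun.Build _ _ _ _ tuple_cons measurable_tuple_cons.

End tuple_cons.

(* The n-fold product measure P (x) ... (x) P, i.e. the joint law of n i.i.d.
   draws from P. *)
Fixpoint iid_law d (T : measurableType d) (R : realType) (P : probability T R)
    (n : nat) : probability (n.-tuple T) R :=
  if n is m.+1 then
    distribution (P \x iid_law P m)%E (@tuple_cons d T m)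
  else dirac [tuple].

Lemma iid_law_box d (T : measurableType d) (R : realType) (P : probability T R)
    (n : nat) (B : 'I_n -> set T) : (forall i, measurable (B i)) ->
  iid_law P n [set t | forall i, B i (tnth t i)] = (\prod_(i < n) P (B i))%E.
Proof.
elim: n B => [|n IHn] B mB.
  rewrite big_ord0 /= diracE mem_set//= => i; by case: i.
rewrite big_ord_recl -(IHn (fun i => B (lift ord0 i)))// -product_measure1E//.
  rewrite /= /distribution /pushforward; congr ((_ \x _)%E _).
  apply/seteqP; split => [[x t] /= h|[x t] /= [h0 h] i].
    split => [|i]; first by have := h ord0.
    by have := h (lift ord0 i); rewrite tnthS.
  by have [j ->|->//] := unliftP ord0 i; rewrite tnthS; exact: h.
rewrite (_ : mkset _ = \bigcap_(i in [set: 'I_n])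
    ((@tnth n T ^~ i) @^-1` B (lift ord0 i))); last first.
  by apply/seteqP; split => t h i; [move=> _; exact: h|exact: h].
apply: fin_bigcap_measurable => // i _.
by rewrite -[X in measurable X]setTI; exact: measurable_tnth.
Qed.

(* Matrices carry the sigma-algebra generated by the entries; for real entries
   this is the Borel sigma-algebra. *)
Definition measure_matrix_display : measure_display -> measure_display.
Proof. exact. Qed.

Section measurable_matrix.
Context d (T : measurableType d) (m n : nat).

Definition matrix_measurable : set (set 'M[T]_(m, n)) :=
  <<s \bigcup_(ij in [set: 'I_m * 'I_n])
        preimage_set_system setT (fun A : 'M[T]_(m, n) => A ij.1 ij.2)
          measurable >>.

Let matrix_measurable0 : matrix_measurable set0.
Proof. exact: sigma_algebra0. Qed.

Let matrix_measurableC A : matrix_measurable A -> matrix_measurable (~` A).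
Proof. exact: sigma_algebraC. Qed.

Let matrix_measurable_bigcup (F : (set 'M[T]_(m, n))^nat) :
  (forall i, matrix_measurable (F i)) -> matrix_measurable (\bigcup_i F i).
Proof. exact: sigma_algebra_bigcup. Qed.

HB.instance Definition _ := @isMeasurable.Build (measure_matrix_display d)
  'M[T]_(m, n) matrix_measurable matrix_measurable0 matrix_measurableC
  matrix_measurable_bigcup.

End measurable_matrix.

Section standard_gaussian.
Context (R : realType) (n : nat).

(* measurableTypeR R is R under the display used by normal_prob. *)
Definition col_of_tuple (t : n.-tuple (measurableTypeR R)) : 'cV[R]_n :=
  \col_i tnth t i.

Lemma measurable_col_of_tuple : measurable_fun setT col_of_tuple.
Proof.
apply: (measurability (\bigcup_(ij in [set: 'I_n * 'I_1])
  preimage_set_system setT (fun A : 'cV[R]_n => A ij.1 ij.2) measurable)) => //.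
move=> _ [_ [[i j] _ [B mB <-]] <-]; rewrite !setTI /=.
rewrite (_ : _ @^-1` _ = (@tnth n (measurableTypeR R) ^~ i) @^-1` B); last first.
  by apply/seteqP; split => t /=; rewrite mxE.
by rewrite -[X in measurable X]setTI; exact: measurable_tnth.
Qed.

HB.instance Definition _ :=
  isMeasurableFun.Build _ _ _ _ col_of_tuple measurable_col_of_tuple.

(* N(0, I_n) *)
Definition gaussian : probability 'cV[R]_n R :=
  distribution (iid_law (normal_prob (0 : R) 1) n) col_of_tuple.

End standard_gaussian.
Arguments gaussian : clear implicits.

Definition independent d d1 d2 (T : measurableType d) (T1 : measurableType d1)
    (T2 : measurableType d2) (R : realType) (P : probability T R)
    (X : T -> T1) (Y : T -> T2) : Prop :=
  forall A B, measurable A -> measurable B ->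
    P (X @^-1` A `&` Y @^-1` B) = (P (X @^-1` A) * P (Y @^-1` B))%E.

Section euclidean_space.
Context (R : realType).

Definition euclid_norm n (v : 'cV[R]_n) : R := Num.sqrt (\sum_i v i 0 ^+ 2).

Definition op_norm m n (f : 'Hom('cV[R]_m, 'cV[R]_n)) : R :=
  sup [set euclid_norm (f v) | v in [set v | euclid_norm v <= 1]].

Definition orth_compl n (S : {vspace 'cV[R]_n}) : {vspace 'cV[R]_n} :=
  (\bigcap_(i < \dim S) lker (linfun (mulmx ((vbasis S)`_i)^T)))%VS.

(* daddv_pi S S' is the projection onto S along S'. *)
Definition orth_proj n (S : {vspace 'cV[R]_n}) : 'End('cV[R]_n) :=
  daddv_pi S (orth_compl S).

Definition subspace_dist n (S S' : {vspace 'cV[R]_n}) : R :=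
  op_norm (orth_proj S - orth_proj S').

Definition col_span m n (W : 'M[R]_(m, n)) : {vspace 'cV[R]_m} :=
  <<[seq col j W | j : 'I_n]>>%VS.

Lemma memv_orth_compl n (S : {vspace 'cV[R]_n}) v :
  reflect (forall u, u \in S -> u^T *m v = 0) (v \in orth_compl S).
Proof.
rewrite -[v \in _]/(<[v]> <= _)%VS.
apply: (iffP subv_bigcapP) => [h u uS|h i _].
  rewrite (coord_vbasis uS) raddf_sum/= mulmx_suml big1// => i _.
  rewrite linearZ/= -scalemxAl.
  by have := h i isT; rewrite -memvE memv_ker lfunE/= => /eqP ->; rewrite scaler0.
rewrite -memvE memv_ker lfunE/=; apply/eqP/h/vbasis_mem/mem_nth.
by rewrite size_tuple.
Qed.

Let dim_cV n : \dim (fullv : {vspace 'cV[R]_n}) = n.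
Proof. by rewrite dimvf /dim/= muln1. Qed.

Lemma capv_orth_compl n (S : {vspace 'cV[R]_n}) : (S :&: orth_compl S = 0)%VS.
Proof.
apply/eqP; rewrite -subv0; apply/subvP => v.
rewrite memv_cap memv0 => /andP[vS /memv_orth_compl/(_ v vS)/matrixP/(_ 0 0)].
rewrite !mxE => /eqP; rewrite psumr_eq0 => [/allP h|i _]; last first.
  by rewrite mxE -expr2 sqr_ge0.
apply/eqP/matrixP => i j; rewrite (ord1 j) mxE; apply/eqP.
by have := h i (mem_index_enum i); rewrite mxE mulf_eq0 orbb.
Qed.

Lemma dim_orth_compl n (S : {vspace 'cV[R]_n}) :
  (\dim S + \dim (orth_compl S) = n)%N.
Proof.
apply/eqP; rewrite eqn_leq; apply/andP; split.
  rewrite -(dimv_disjoint_sum (capv_orth_compl S)).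
  by rewrite (leq_trans (dimvS (subvf _)))// dim_cV.
pose f : 'Hom('cV[R]_n, 'cV[R]_(\dim S)) :=
  linfun (mulmx (\matrix_(i < \dim S, j < n) ((vbasis S)`_i) j 0)).
have kf : (lker f <= orth_compl S)%VS.
  apply/subvP => v; rewrite memv_ker lfunE/= => /eqP fv.
  rewrite memvE; apply/subv_bigcapP => i _.
  rewrite -memvE memv_ker lfunE/=; apply/eqP/matrixP => a b.
  have /matrixP/(_ i b) := fv; rewrite [in RHS]mxE => fvi.
  rewrite [in RHS]mxE -[RHS]fvi !mxE.
  by apply: eq_bigr => k _; rewrite !mxE (ord1 a).
have := limg_ker_dim f fullv.
rewrite capfv dim_cV => dimf; rewrite -[leqLHS]dimf.
rewrite addnC leq_add// ?dimvS//.
by rewrite (leq_trans (dimvS (subvf _)))// dim_cV.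
Qed.

Lemma orth_proj_mem n (S : {vspace 'cV[R]_n}) v : orth_proj S v \in S.
Proof. exact: memv_pi. Qed.

Lemma orth_proj_compl n (S : {vspace 'cV[R]_n}) v :
  v - orth_proj S v \in orth_compl S.
Proof.
have vT : v \in (S + orth_compl S)%VS.
  suff -> : (S + orth_compl S = fullv)%VS by exact: memvf.
  apply/eqP; rewrite eqEdim subvf dim_cV.
  by rewrite (dimv_disjoint_sum (capv_orth_compl S)) dim_orth_compl leqnn.
rewrite -{1}(daddv_pi_add (capv_orth_compl S) vT) addrAC subrr add0r.
exact: memv_pi.
Qed.

End euclidean_space.

Section relu_networks.
Context (R : realType).

Inductive relu_network : forall m n, ('cV[R]_m -> 'cV[R]_n) -> Prop :=
| relu_network_affine m n (A : 'M[R]_(n, m)) (b : 'cV[R]_n) :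
    relu_network (fun x : 'cV[R]_m => A *m x + b)
| relu_network_relu n :
    relu_network (fun x : 'cV[R]_n => map_mx (fun t => Num.max t 0) x)
| relu_network_comp m n p (g : 'cV[R]_n -> 'cV[R]_p)
    (f : 'cV[R]_m -> 'cV[R]_n) :
    relu_network g -> relu_network f -> relu_network (g \o f).

Definition scalar_relu_network r (sigma : 'cV[R]_r -> R) : Prop :=
  exists2 f : 'cV[R]_r -> 'cV[R]_1,
    relu_network f & forall x, sigma x = f x 0 0.

(* The random vector Z ~ N(0, I_r) is the identity on (R^r, gaussian R r). *)
Definition full_intrinsic_dimension r (sigma : 'cV[R]_r -> R) : Prop :=
  ~ exists S : {vspace 'cV[R]_r}, S <> fullv /\
      independent (gaussian R r)
        (fun z => orth_proj (orth_compl S) z)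
        (fun z => (orth_proj S z, sigma z)).

End relu_networks.

Section estimators.
Context (R : realType) (d n : nat).

(* An estimator is a measurable map into the r-dimensional subspaces, the
   sigma-algebra on subspaces being generated by S |-> orth_proj S v for all v
   (equivalently, by the entries of the projection matrix). *)
Definition subspace_estimator (r : nat)
    (Shat : n.-tuple ('cV[R]_d * R) -> {vspace 'cV[R]_d}) : Prop :=
  (forall D, \dim (Shat D) = r) /\
  (forall v, measurable_fun setT (fun D => orth_proj (Shat D) v)).

Definition labelled_sample (f : 'cV[R]_d -> R) (x : n.-tuple 'cV[R]_d) :
  n.-tuple ('cV[R]_d * R) := [tuple of [seq (z, f z) | z <- x]].

End estimators.

(* Main.v *)
(* The labels are noiseless and sigma is piecewise affine, so the span of W can be
   recovered exactly from O(d) samples. Almost surely every set of d + 1 sample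
   points is affinely independent. Hence an affine function that fits K (d + 1)
   samples exactly, K being the number of pieces of sigma, shares d + 1 samples
   with some piece a^T z + b and so equals x |-> a^T W^T x + b; its slope W a lies
   in the span of W. Conversely, a piece of positive Gaussian probability receives
   K (d + 1) samples outside an event of probability exp(- d) once n >= C d, so
   that W a is the slope of an exact fit. The estimator spans r independent slopes
   of exact fits, and it returns the span of W as soon as the slopes a of the
   pieces of positive probability span R^r. They do: these pieces cover R^r, so if
   v were orthogonal to all their slopes, sigma would be invariant along v, and by
   rotation invariance of the Gaussian the component of Z along v would be
   independent of the other components and sigma(Z), against the assumption on the
   intrinsic dimension. *)

Require Import Defs.
From HB Require Import structures.
From mathcomp Require Import all_boot all_order all_algebra.
From mathcomp Require Import all_classical all_reals all_analysis.
From mathcomp Require Import measurable_realfun ring lra.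

Set Implicit Arguments.
Unset Strict Implicit.
Unset Printing Implicit Defensive.

Import Order.TTheory GRing.Theory Num.Theory.
Import numFieldNormedType.Exports.

Local Open Scope classical_set_scope.
Local Open Scope ring_scope.

(** * Rotation invariance of the Gaussian *)

(** Measurability shapes the estimator: fits are explicit solutions of normal equations,
    independence is tested by determinants, and the choice among fits is a finite case distinction.
    Affine independence of samples becomes invertibility of the second moment matrix of the vectors
    [homog x], the point with a coordinate 1 appended. A piece is the whole set where [sigma] agrees
    with a given affine function, not a cell of the network. The geometry of cells is replaced by
    two facts: finitely many candidate values at each point, and a Lipschitz bound. Together they
    make the complement of the pieces of positive probability open, and they make [sigma] constant
    along a direction orthogonal to all slopes, since a Lipschitz function of one variable with
    finitely many values is constant. The Gaussian is defined as the law of independent coordinates,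
    so its rotation invariance has to be derived; it gives the pulled-back pieces probabilities that
    do not depend on [d]. The estimator sees [sigma] only through the number K of pieces. As
    recovery is exact, [eps <= 1] serves to pass from C d / eps^2 to C d, and the failure bound
    exp(- d) allows c = 1. *)

Section gaussian_plane_rotation.
Context (R : realType).
Local Notation mu := (@lebesgue_measure R).
Local Notation T1 := (measurableTypeR R).
Local Open Scope ereal_scope.

(** Change of variables holds for the Radon-Nikodym derivative of the normal law; it has the same
    integral as the density over every measurable set, so the two agree almost everywhere. *)
Lemma ge0_integral_normal_prob (m s : R) (f : R -> \bar R) : s != 0%R ->
  measurable_fun setT f -> (forall x, 0 <= f x) ->
  \int[normal_prob m s]_x f x = \int[mu]_x (f x * (normal_pdf m s x)%:E).
Proof.
move=> s0 mf f0; have dom := normal_prob_dominates m s.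
have mpdf : measurable_fun setT (fun x : R => (normal_pdf m s x)%:E).
  by apply/measurable_EFinP; exact: measurable_normal_pdf.
rewrite -(Radon_Nikodym_SigmaFinite.change_of_variables dom)//.
have mRN := measurable_int mu (Radon_Nikodym_SigmaFinite.f_integrable dom).
apply: ae_eq_integral => //.
- exact: emeasurable_funM.
- exact: emeasurable_funM.
apply: ae_eqe_mul2l; apply: integral_ae_eq => //.
- exact: Radon_Nikodym_SigmaFinite.f_integrable.
- by move=> E _ mE; rewrite -Radon_Nikodym_SigmaFinite.f_integral.
Qed.

Lemma measurable_affine (a b : R) :
  @measurable_fun _ _ T1 T1 setT (fun x => a * x + b)%R.
Proof. by apply: measurable_funD => //; exact: measurable_funM. Qed.

(** By uniqueness of Lebesgue measure, half-open intervals suffice; a negative [a] moves the closed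
    end to the left without changing the length. *)
Lemma lebesgue_measure_affine (a b : R) (A : set R) : a != 0%R -> measurable A ->
  mu A = `|a|%:E * mu [set x | A (a * x + b)%R].
Proof.
move=> a0 mA.
pose k : {nonneg R} := NngNum (normr_ge0 a).
pose nu := measure_function_pushforward__canonical__measure_function_Measure
  mu (measurable_affine a b).
rewrite -[RHS]/(mscale k nu A).
apply: (@lebesgue_measure_unique R (mscale k nu)) => // _ [[u v] _ <-] /=.
rewrite /mscale/= /pushforward/=.
have [a_gt0|a_lt0|a00] := ltgtP 0%R a; last by rewrite a00 eqxx in a0.
- rewrite gtr0_norm// (_ : _ @^-1` _ = `]((u - b) / a)%R, ((v - b) / a)%R]%classic).
    rewrite !lebesgue_measure_itv/= !lte_fin ltr_pM2r ?invr_gt0// ltrD2r.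
    case: ifPn => _; last by rewrite mule0.
    by rewrite -!EFinB -EFinM; congr EFin; field.
  by apply/seteqP; split => x /=; rewrite !in_itv/= ltr_pdivrMr// ler_pdivlMr//
    ltrBlDr lerBrDr mulrC.
- rewrite ltr0_norm// (_ : _ @^-1` _ = `[((v - b) / a)%R, ((u - b) / a)%R[%classic).
    rewrite !lebesgue_measure_itv/= !lte_fin ltr_nM2r ?invr_lt0// ltrD2r.
    case: ifPn => _; last by rewrite mule0.
    by rewrite -!EFinB -EFinM; congr EFin; field.
  by apply/seteqP; split => x /=; rewrite !in_itv/= ltr_ndivlMr// ler_ndivrMr//
    ltrBlDr lerBrDr mulrC => /andP[-> ->].
Qed.

Lemma ge0_integral_affine (a b : R) (f : R -> \bar R) : a != 0%R ->
  measurable_fun setT f -> (forall x, 0 <= f x) ->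
  \int[mu]_x f x = `|a|%:E * \int[mu]_x f (a * x + b)%R.
Proof.
move=> a0 mf f0.
pose k : {nonneg R} := NngNum (normr_ge0 a).
pose nu := measure_function_pushforward__canonical__measure_function_Measure
  mu (measurable_affine a b).
have -> : \int[mu]_x f x = \int[mscale k nu]_x f x.
  by apply: eq_measure_integral => A mA _; exact: lebesgue_measure_affine.
rewrite ge0_integral_mscale// ge0_integral_pushforward//.
by apply: measurable_affine.
Qed.
Lemma ge0_integral_comp_affine (a b : R) (f : R -> \bar R) : a != 0%R ->
  measurable_fun setT f -> (forall x, 0 <= f x) ->
  \int[mu]_x f (a * x + b)%R = `|a^-1|%:E * \int[mu]_x f x.
Proof.
move=> a0 mf f0; rewrite (ge0_integral_affine b a0 mf f0) muleA -EFinM.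
by rewrite normfV mulVf ?normr_eq0// mul1e.
Qed.

Lemma measurable_lin2 (a b : R) :
  @measurable_fun _ _ (T1 * T1)%type T1 setT (fun p => a * p.1 + b * p.2)%R.
Proof.
by apply: measurable_funD; apply: measurable_funM.
Qed.

(* A plane rotation is the product of two shears composed with two reciprocal
   dilations, so one-dimensional substitutions and Tonelli suffice. *)
Lemma lebesgue_plane_rotation (c s : R) (H : T1 * T1 -> \bar R) :
  (c ^+ 2 + s ^+ 2 = 1)%R -> measurable_fun setT H -> (forall p, 0 <= H p) ->
  \int[mu]_x \int[mu]_y H (c * x + - s * y, s * x + c * y)%R =
  \int[mu]_x \int[mu]_y H (x, y).
Proof.
move=> cs mH H0.
have mHL a b a' b' : measurable_fun setT
    (fun p : T1 * T1 => H (a * p.1 + b * p.2, a' * p.1 + b' * p.2)%R).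
  by apply: measurableT_comp => //; apply: measurable_fun_pair => /=;
    exact: measurable_lin2.
(* The shears below divide by [c]. For [c = 0] the rotation is a swap of the coordinates with one
   sign change. *)
have [c0|c0] := eqVneq c 0%R.
  have s1 : `|s^-1|%R = 1%R.
    have : (`|s| ^+ 2 = 1)%R by rewrite real_normK ?num_real// -cs c0 expr0n add0r.
    move/eqP; rewrite sqrf_eq1 => /orP[/eqP s1|/eqP s1].
      by rewrite normfV s1 invr1.
    by have := normr_ge0 s; rewrite s1 oppr_ge0 ler10.
  have s0 : (- s != 0)%R.
    by rewrite oppr_eq0; apply: contra_eq_neq s1 => ->; rewrite invr0 normr0 eq_sym oner_neq0.
  rewrite c0; under eq_integral do under eq_integral do rewrite !mul0r add0r addr0.
  transitivity (\int[mu]_x \int[mu]_y H (y, s * x)%R).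
    apply: eq_integral => x _.
    under eq_integral do rewrite -[(- s * _)%R]addr0.
    rewrite (@ge0_integral_comp_affine _ _ (fun y => H (y, s * x)%R))//.
      by rewrite invrN normrN s1 mul1e.
    exact: measurableT_comp.
  rewrite -(fubini_tonelli (fun p : T1 * T1 => H (p.1, s * p.2)%R))//=; last first.
    have := mHL 1%R 0%R 0%R s.
    by under eq_fun do rewrite !mul0r mul1r addr0 add0r.
  apply: eq_integral => x _.
  under eq_integral do rewrite -[(s * _)%R]addr0.
  rewrite (@ge0_integral_comp_affine _ _ (fun y => H (x, y)))//.
  - by rewrite s1 mul1e.
  - by rewrite -oppr_eq0.
  - exact: measurableT_comp.
rewrite (fubini_tonelli (fun p : T1 * T1 =>
  H (c * p.1 + - s * p.2, s * p.1 + c * p.2)%R))//=.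
have mF y : measurable_fun setT (fun x => H (x, s / c * x + c^-1 * y)%R).
  apply: measurableT_comp => //; apply: measurable_fun_pair => //=.
  exact: measurable_affine.
(* For fixed [y], the first coordinate [c * x + - s * y] becomes the variable, and by [cs] the
   second one reads [s / c * x + c^-1 * y]. The factor from this substitution cancels the one from
   the later substitution in [y]. *)
transitivity (\int[mu]_y (`|c^-1|%:E * \int[mu]_x H (x, s / c * x + c^-1 * y)%R)).
  apply: eq_integral => y _; rewrite -(ge0_integral_comp_affine (- s * y)%R)//=.
  apply: eq_integral => x _; congr (H (_, _)).
  rewrite (_ : c^-1 * y = (c ^+ 2 + s ^+ 2) / c * y)%R; last by rewrite cs mul1r.
  by field.
have mG := mHL 1%R 0%R (s / c)%R c^-1%R.
have {}mG : measurable_fun setT (fun p : T1 * T1 => H (p.1, s / c * p.1 + c^-1 * p.2)%R).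
  by apply: eq_measurable_fun mG => p _; rewrite mul1r mul0r addr0.
rewrite ge0_integralZl//; last 2 first.
- exact: (measurable_fun_fubini_tonelli_G _ mG).
- by move=> y _; exact: integral_ge0.
rewrite -(fubini_tonelli (fun p : T1 * T1 => H (p.1, s / c * p.1 + c^-1 * p.2)%R))//=.
rewrite -ge0_integralZl//; last 2 first.
- exact: (measurable_fun_fubini_tonelli_F _ mG).
- by move=> x _; exact: integral_ge0.
apply: eq_integral => x _; under eq_integral do rewrite addrC.
rewrite (@ge0_integral_comp_affine _ _ (fun y => H (x, y)))//.
- by rewrite muleA -EFinM -normrM mulfV ?invr_eq0// normr1 mul1e.
- by rewrite invr_eq0.
- exact: measurableT_comp.
Qed.

(** The product density depends only on [x ^+ 2 + y ^+ 2], which the rotation preserves; the claim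
    is the Lebesgue one for the integrand weighted by that density. *)
Lemma gaussian_plane_rotation (c s : R) (h : T1 * T1 -> \bar R) :
  (c ^+ 2 + s ^+ 2 = 1)%R -> measurable_fun setT h -> (forall p, 0 <= h p) ->
  let N := normal_prob (0 : R) 1 in
  \int[N]_x \int[N]_y h (c * x + - s * y, s * x + c * y)%R =
  \int[N]_x \int[N]_y h (x, y).
Proof.
move=> cs mh h0 N.
pose phi : R -> R := normal_pdf 0 1.
have phi0 x : 0 <= (phi x)%:E by rewrite lee_fin normal_pdf_ge0.
have mphi : measurable_fun setT (fun x : T1 => (phi x)%:E).
  by apply/measurable_EFinP; exact: measurable_normal_pdf.
have phi2 x y : (phi x * phi y =
    normal_peak 1 ^+ 2 * expR (- (x ^+ 2 + y ^+ 2) / (1 ^+ 2 *+ 2)))%R.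
  rewrite /phi normal_pdfE ?oner_neq0// /normal_fun !subr0 mulrACA -expr2 -expRD.
  by rewrite -mulrDl -opprD.
have E (g : T1 * T1 -> \bar R) : measurable_fun setT g -> (forall p, 0 <= g p) ->
    \int[N]_x \int[N]_y g (x, y) =
    \int[mu]_x \int[mu]_y (g (x, y) * (phi x * phi y)%:E).
  move=> mg g0; rewrite ge0_integral_normal_prob//; last 2 first.
  - exact: (measurable_fun_fubini_tonelli_F _ mg).
  - by move=> x; exact: integral_ge0.
  apply: eq_integral => x _.
  rewrite ge0_integral_normal_prob//; last exact: measurableT_comp.
  rewrite muleC -ge0_integralZl//; last 2 first.
  - by apply: emeasurable_funM => //; exact: measurableT_comp.
  - by move=> y _; exact: mule_ge0.
  by apply: eq_integral => y _; rewrite EFinM muleCA.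
move: phi phi0 mphi phi2 E => phi phi0 mphi phi2 E.
pose hG p := h (c * p.1 + - s * p.2, s * p.1 + c * p.2)%R.
have mhG : measurable_fun setT hG.
  by apply: measurableT_comp => //; apply: measurable_fun_pair => /=;
    exact: measurable_lin2.
apply: (etrans (E hG mhG (fun=> h0 _))); apply/esym; apply: (etrans (E h mh h0)).
rewrite -(lebesgue_plane_rotation (H := fun p => h p * (phi p.1 * phi p.2)%:E) cs)/=.
- apply: eq_integral => x _; apply: eq_integral => y _.
  rewrite (phi2 x y) (phi2 (c * x + - s * y)%R).
  have -> // : (x ^+ 2 + y ^+ 2 = (c * x + - s * y) ^+ 2 + (s * x + c * y) ^+ 2)%R.
  by rewrite -[LHS]mul1r -cs; ring.
- apply: emeasurable_funM => //.
  under eq_fun do rewrite EFinM.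
  by apply: emeasurable_funM; apply: (measurableT_comp mphi).
- by move=> p; rewrite mule_ge0// EFinM mule_ge0.
Qed.

End gaussian_plane_rotation.

(** * Completion of orthonormal columns *)

Section orthonormal_extension.
Context (R : rcfType).

Lemma cV_sqr_ge0 n (v : 'cV[R]_n) : 0 <= (v^T *m v) 0 0.
Proof. by rewrite mxE sumr_ge0// => i _; rewrite mxE -expr2 sqr_ge0. Qed.

Lemma cV_sqr_eq0 n (v : 'cV[R]_n) : ((v^T *m v) 0 0 == 0) = (v == 0).
Proof.
apply/idP/eqP => [|->]; last by rewrite mulmx0 mxE.
rewrite mxE psumr_eq0 => [/allP h|i _]; last by rewrite mxE -expr2 sqr_ge0.
apply/matrixP => i j; rewrite (ord1 j) mxE; apply/eqP.
by have := h i (mem_index_enum i); rewrite mxE mulf_eq0 orbb.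
Qed.

Lemma cV_normalize n (v : 'cV[R]_n) : v != 0 ->
  let w := (Num.sqrt ((v^T *m v) 0 0))^-1 *: v in w^T *m w = 1%:M.
Proof.
move=> v0 w; rewrite /w [(_ *: v)^T]linearZ/= -scalemxAl -scalemxAr scalerA -invfM -expr2.
rewrite sqr_sqrtr ?cV_sqr_ge0//.
have {2}-> : v^T *m v = ((v^T *m v) 0 0)%:M by exact: mx11_scalar.
by rewrite scale_scalar_mx mulVf ?cV_sqr_eq0.
Qed.

(** As long as [row_mx W W'] has fewer columns than rows, some nonzero vector is orthogonal to all
    its columns; normalized, it is the next column. *)
Lemma orthonormal_extension d k j (W : 'M[R]_(d, k)) :
  W^T *m W = 1%:M -> (k + j <= d)%N ->
  exists W' : 'M[R]_(d, j), W'^T *m W' = 1%:M /\ W^T *m W' = 0.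
Proof.
move=> WW; elim: j => [_|j IH kj].
  by exists 0; split; [apply/matrixP => -[]|rewrite mulmx0].
have [|W' [W'W' WW']] := IH; first by rewrite (leq_trans _ kj)// addnS.
pose M := row_mx W W'.
have : kermx M != 0.
  rewrite -mxrank_eq0 mxrank_ker subn_eq0 -ltnNge.
  by rewrite (leq_ltn_trans (rank_leq_col _))// -addnS.
move=> /rowV0Pn[u /sub_kermxP uM u0].
have v0 : u^T != 0 by rewrite trmx_eq0.
pose v := (Num.sqrt ((u^T^T *m u^T) 0 0))^-1 *: u^T.
have vM : v^T *m M = 0 by rewrite /v linearZ/= trmxK -scalemxAl uM scaler0.
have [vW vW'] : v^T *m W = 0 /\ v^T *m W' = 0.
  by move: vM; rewrite mul_mx_row -[0]row_mx0 => /eq_row_mx.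
suff : (row_mx v W')^T *m row_mx v W' = 1%:M /\ W^T *m row_mx v W' = 0.
  by exists (row_mx v W').
split.
  rewrite tr_row_mx mul_col_row W'W' vW' -[W'^T *m v]trmxK trmx_mul trmxK vW'.
  by rewrite trmx0 cV_normalize// -scalar_mx_block.
rewrite mul_mx_row WW' -[W^T *m v]trmxK trmx_mul trmxK vW trmx0.
exact: row_mx0.
Qed.

Lemma orthogonal_completion r e (W : 'M[R]_(r + e, r)) : W^T *m W = 1%:M ->
  exists W' : 'M[R]_(r + e, e), (row_mx W W')^T *m row_mx W W' = 1%:M.
Proof.
move=> WW; have [W' [W'W' WW']] := orthonormal_extension WW (leqnn _).
exists W'; rewrite tr_row_mx mul_col_row WW W'W' WW'.
by rewrite -[W'^T *m W]trmxK trmx_mul trmxK WW' trmx0 -scalar_mx_block.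
Qed.

End orthonormal_extension.

(** * Measurability of matrix operations *)

Section measurable_matrices.
Context (R : realType).

Lemma measurable_preimageT d d' (T : measurableType d) (T' : measurableType d')
    (f : T -> T') (A : set T') :
  measurable_fun setT f -> measurable A -> measurable (f @^-1` A).
Proof. by move=> mf mA; rewrite -[X in measurable X]setTI; exact: mf. Qed.

Lemma measurable_exists_seq d (T : measurableType d) (I : eqType) (l : seq I)
    (F : I -> set T) : (forall i, i \in l -> measurable (F i)) ->
  measurable [set t | exists2 i, i \in l & F i t].
Proof.
elim: l => [_|j l IH mF].
  by rewrite (_ : mkset _ = set0)//; apply/seteqP; split => t // -[].
rewrite (_ : mkset _ = F j `|` [set t | exists2 i, i \in l & F i t]).
  apply: measurableU; first by apply: mF; rewrite mem_head.
  by apply: IH => i il; apply: mF; rewrite inE il orbT.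
apply/seteqP; split => t /=.
  by move=> [i]; rewrite inE => /predU1P[->|il Fi]; [left|right; exists i].
by move=> [Fj|[i il Fi]]; [exists j; rewrite ?mem_head|exists i; rewrite ?inE ?il ?orbT].
Qed.

Lemma measure_exists_seq_le d (T : measurableType d)
    (mu : {measure set T -> \bar R}) (I : eqType) (l : seq I) (F : I -> set T) :
  (forall i, i \in l -> measurable (F i)) ->
  (mu [set t | exists2 i, i \in l & F i t] <= \sum_(i <- l) mu (F i))%E.
Proof.
elim: l => [_|j l IH mF].
  by rewrite big_nil (_ : mkset _ = set0) ?measure0//; apply/seteqP; split => t // -[].
have mFj : measurable (F j) by apply: mF; rewrite mem_head.
have mFl i : i \in l -> measurable (F i) by move=> il; apply: mF; rewrite inE il orbT.
rewrite (_ : mkset _ = F j `|` [set t | exists2 i, i \in l & F i t]); last first.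
  apply/seteqP; split => t /=.
    by move=> [i]; rewrite inE => /predU1P[->|il Fi]; [left|right; exists i].
  by move=> [Fj|[i il Fi]]; [exists j; rewrite ?mem_head|exists i; rewrite ?inE ?il ?orbT].
rewrite big_cons (le_trans (measureU2 _ mFj (measurable_exists_seq mFl)))//.
by rewrite leeD2l// IH.
Qed.

Lemma measurable_mx_entry m n (i : 'I_m) (j : 'I_n) :
  measurable_fun setT (fun A : 'M[R]_(m, n) => A i j).
Proof.
move=> _ B mB; apply: sub_sigma_algebra; exists (i, j) => //=.
by exists B.
Qed.

Context d (T : measurableType d).

Lemma measurable_mxP m n (f : T -> 'M[R]_(m, n)) :
  measurable_fun setT f <-> forall i j, measurable_fun setT (fun x => f x i j).
Proof.
split=> [mf i j|mf].
  exact: (measurableT_comp (measurable_mx_entry i j) mf).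
apply: (measurability (\bigcup_(ij in [set: 'I_m * 'I_n])
  preimage_set_system setT (fun A : 'M[R]_(m, n) => A ij.1 ij.2) measurable)) => //.
move=> _ [_ [[i j] _ [B mB <-]] <-]; rewrite !setTI /=.
exact: (measurable_preimageT (mf i j)).
Qed.

Lemma measurable_mulmx m n p (f : T -> 'M[R]_(m, n)) (g : T -> 'M[R]_(n, p)) :
  measurable_fun setT f -> measurable_fun setT g ->
  measurable_fun setT (fun x => f x *m g x).
Proof.
move=> /measurable_mxP mf /measurable_mxP mg; apply/measurable_mxP => i j.
under eq_fun do rewrite mxE.
by apply: measurable_sum => k; exact: measurable_funM.
Qed.

Lemma measurable_addmx m n (f g : T -> 'M[R]_(m, n)) :
  measurable_fun setT f -> measurable_fun setT g ->
  measurable_fun setT (fun x => f x + g x).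
Proof.
move=> /measurable_mxP mf /measurable_mxP mg; apply/measurable_mxP => i j.
by under eq_fun do rewrite mxE; exact: measurable_funD.
Qed.

Lemma measurable_summx m n I (s : seq I) (P : pred I) (f : I -> T -> 'M[R]_(m, n)) :
  (forall i, P i -> measurable_fun setT (f i)) ->
  measurable_fun setT (fun x => \sum_(i <- s | P i) f i x).
Proof.
move=> mf; elim: s => [|i s IH].
  by under eq_fun do rewrite big_nil; exact: measurable_cst.
under eq_fun do rewrite big_cons.
by case: (P i) (mf i) => [/(_ isT) mfi|//]; exact: measurable_addmx.
Qed.

Lemma measurable_scalemx m n (a : T -> R) (f : T -> 'M[R]_(m, n)) :
  measurable_fun setT a -> measurable_fun setT f ->
  measurable_fun setT (fun x => a x *: f x).
Proof.
move=> ma /measurable_mxP mf; apply/measurable_mxP => i j.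
by under eq_fun do rewrite mxE; exact: measurable_funM.
Qed.

Lemma measurable_trmx m n (f : T -> 'M[R]_(m, n)) :
  measurable_fun setT f -> measurable_fun setT (fun x => (f x)^T).
Proof.
move=> /measurable_mxP mf; apply/measurable_mxP => i j.
by under eq_fun do rewrite mxE; exact: mf.
Qed.

Lemma measurable_col_mx m1 m2 n (f : T -> 'M[R]_(m1, n)) (g : T -> 'M[R]_(m2, n)) :
  measurable_fun setT f -> measurable_fun setT g ->
  measurable_fun setT (fun x => col_mx (f x) (g x)).
Proof.
move=> /measurable_mxP mf /measurable_mxP mg; apply/measurable_mxP => i j.
rewrite -[i]splitK; case: (fintype.split i) => k /=.
  by under eq_fun do rewrite col_mxEu; exact: mf.
by under eq_fun do rewrite col_mxEd; exact: mg.
Qed.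

Lemma measurable_usubmx m1 m2 n (f : T -> 'M[R]_(m1 + m2, n)) :
  measurable_fun setT f -> measurable_fun setT (fun x => usubmx (f x)).
Proof.
move=> /measurable_mxP mf; apply/measurable_mxP => i j.
by under eq_fun do rewrite mxE; exact: mf.
Qed.

Lemma measurable_det n (f : T -> 'M[R]_n) :
  measurable_fun setT f -> measurable_fun setT (fun x => \det (f x)).
Proof.
move=> /measurable_mxP mf; apply: measurable_sum => s.
by apply: measurable_funM => //; apply: measurable_prod.
Qed.

(** The inverse is [f x] times the power -1 of [f x ^+ 2]: the base of the power is nonnegative, and
    the factor [f x] gives the conventional value 0 at zeros of [f]. *)
Lemma measurable_funV (f : T -> R) :
  measurable_fun setT f -> measurable_fun setT (fun x => (f x)^-1).
Proof.
move=> mf; rewrite (_ : (fun x => _) = (fun x => f x * (f x ^+ 2) `^ (-1))).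
  apply: measurable_funM => //.
  by apply: (measurableT_comp (measurable_powR _)); exact: measurable_funX.
apply/funext => x; rewrite powR_inv1 ?sqr_ge0//.
have [->|fx0] := eqVneq (f x) 0; first by rewrite invr0 mul0r.
by rewrite expr2 invfM mulrA divff// mul1r.
Qed.

Lemma measurable_invmx n (f : T -> 'M[R]_n) :
  measurable_fun setT f -> measurable_fun setT (fun x => invmx (f x)).
Proof.
move=> mf; rewrite /invmx.
apply: measurable_fun_ifT => //.
  under eq_fun do rewrite unitmxE unitfE.
  by apply: measurable_neg; apply: measurable_fun_eqr => //; exact: measurable_det.
apply: measurable_scalemx; first by apply: measurable_funV; exact: measurable_det.
move/measurable_mxP : mf => mf.
apply/measurable_mxP => i j; under eq_fun do rewrite mxE /cofactor.
apply: measurable_funM => //; apply: measurable_det.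
by apply/measurable_mxP => k l; under eq_fun do rewrite !mxE; exact: mf.
Qed.

End measurable_matrices.

(** * Invariance of the standard Gaussian under orthogonal matrices *)

Section gaussian_invariance.
Context (R : realType).
Local Notation T1 := (measurableTypeR R).
Local Notation N01 := (normal_prob (0 : R) 1).

(* Typed at n.+1 instead of 1 + n to match the recursion of iid_law, which is why
   block lemmas are applied below with explicit dimensions. *)
Definition vcons n (x : R) (v : 'cV[R]_n) : 'cV[R]_n.+1 := col_mx x%:M v.

Lemma measurable_vcons n :
  measurable_fun setT (fun p : T1 * 'cV[R]_n => vcons p.1 p.2).
Proof.
suff H : measurable_fun setT (fun p : T1 * 'cV[R]_n => p.1%:M : 'M[R]_1).
  by have mf := measurable_col_mx H measurable_snd; exact: mf.
apply/measurable_mxP => i j.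
by under eq_fun do rewrite mxE !ord1 eqxx mulr1n; exact: measurable_fst.
Qed.

Lemma measurable_vconsr n (x : R) : measurable_fun setT (@vcons n x).
Proof. exact: (@measurable_col_mx _ _ _ 1 n 1 (cst x%:M) id). Qed.

Lemma measurable_mulmxl m n (Q : 'M[R]_(m, n)) :
  measurable_fun setT (fun v : 'cV[R]_n => Q *m v).
Proof. by apply: measurable_mulmx => //; exact: measurable_cst. Qed.

Lemma col_of_tuple_cons n (x : T1) (t : n.-tuple T1) :
  col_of_tuple (tuple_cons (x, t)) = vcons x (col_of_tuple t).
Proof.
apply/matrixP => i j; rewrite !ord1 !mxE.
by case: splitP => k; rewrite ?ord1 => ik;
  rewrite !mxE ?eqxx ?mulr1n !(tnth_nth 0)/= ik.
Qed.

Lemma gaussian_vcons n (A : set 'cV[R]_n.+1) :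
  gaussian R n.+1 A = (N01 \x gaussian R n)%E [set p | A (vcons p.1 p.2)].
Proof.
apply: eq_integral => x _ /=; congr (iid_law _ _ _).
apply/seteqP; split => t /=; rewrite !xsectionE/= col_of_tuple_cons //.
Qed.

Lemma gaussian_vconsE n (A : set 'cV[R]_n.+1) :
  gaussian R n.+1 A = (\int[N01]_x gaussian R n [set v | A (vcons x v)])%E.
Proof.
rewrite gaussian_vcons; apply: eq_integral => x _ /=.
by congr (gaussian R n _); apply/seteqP; split => v /=; rewrite xsectionE.
Qed.

Definition gaussian_invariant n (Q : 'M[R]_n) := forall A : set 'cV[R]_n,
  measurable A -> gaussian R n [set v | A (Q *m v)] = gaussian R n A.

Lemma gaussian_invariantM n (P Q : 'M[R]_n) :
  gaussian_invariant P -> gaussian_invariant Q -> gaussian_invariant (P *m Q).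
Proof.
move=> iP iQ A mA; rewrite -(iP _ mA).
rewrite -[RHS]iQ; last exact: (measurable_preimageT (measurable_mulmxl P)).
by congr (gaussian R n _); apply/seteqP; split => v /=; rewrite mulmxA.
Qed.

Definition ext1 n (Q : 'M[R]_n) : 'M[R]_n.+1 := (block_mx (1%:M : 'M[R]_1) 0 0 Q : 'M[R]_(1 + n)).

Lemma ext1_vcons n (Q : 'M[R]_n) x (v : 'cV[R]_n) :
  ext1 Q *m vcons x v = vcons x (Q *m v).
Proof.
have := mul_block_col (1%:M : 'M[R]_1) 0 0 Q x%:M v.
by rewrite mul1mx !mul0mx addr0 add0r.
Qed.

Lemma gaussian_invariant_ext1 n (Q : 'M[R]_n) :
  gaussian_invariant Q -> gaussian_invariant (ext1 Q).
Proof.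
move=> iQ A mA; rewrite !gaussian_vconsE; apply: eq_integral => x _.
rewrite -[RHS]iQ; last exact: (measurable_preimageT (measurable_vconsr x)).
congr (gaussian R n _); apply/seteqP; split => v /=.
all: by rewrite ext1_vcons.
Qed.

Definition rot2 n (c s : R) : 'M[R]_n.+2 :=
  (block_mx (c%:M : 'M[R]_1) (row_mx (- s)%:M 0) (col_mx s%:M 0)
    (block_mx (c%:M : 'M[R]_1) 0 0 1%:M) : 'M[R]_(1 + (1 + n))).

Lemma rot2_vcons n (c s x y : R) (v : 'cV[R]_n) :
  rot2 n c s *m vcons x (vcons y v) =
  vcons (c * x + - s * y) (vcons (s * x + c * y) v).
Proof.
apply: (etrans (mul_block_col (c%:M : 'M[R]_1) (row_mx (- s)%:M 0)
  (col_mx s%:M 0) (block_mx (c%:M : 'M[R]_1) 0 0 1%:M) x%:M (col_mx y%:M v))).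
rewrite mul_row_col mul_col_mx mul_block_col.
by rewrite !mul0mx mul1mx !addr0 add_col_mx !add0r -!scalar_mxM -!raddfD.
Qed.

(** Once the last [n] coordinates are integrated out, the measure [h] of the section of [A] is a
    measurable function on the plane, to which the two-dimensional case applies. *)
Lemma gaussian_invariant_rot2 n (c s : R) :
  c ^+ 2 + s ^+ 2 = 1 -> gaussian_invariant (rot2 n c s).
Proof.
move=> cs A mA.
pose B : set ((T1 * T1) * 'cV[R]_n) := [set q | A (vcons q.1.1 (vcons q.1.2 q.2))].
have mB : measurable B.
  pose Q := ((T1 * T1) * 'cV[R]_n)%type.
  have m12 : measurable_fun setT (fun q : Q => q.1.2) by exact: measurableT_comp.
  have m11 : measurable_fun setT (fun q : Q => q.1.1) by exact: measurableT_comp.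
  have m2 := measurableT_comp (@measurable_vcons n)
    (measurable_fun_pair m12 measurable_snd).
  have m1 := measurableT_comp (@measurable_vcons n.+1)
    (measurable_fun_pair m11 m2).
  exact: (measurable_preimageT m1 mA).
pose h := gaussian R n \o xsection B.
have mh : measurable_fun setT h by exact: measurable_fun_xsection.
have hE x y : h (x, y) = gaussian R n [set v | A (vcons x (vcons y v))].
  by congr (gaussian R n _); apply/seteqP; split => v; rewrite /= xsectionE.
rewrite !gaussian_vconsE.
under eq_integral do rewrite gaussian_vconsE.
under [RHS]eq_integral do (rewrite gaussian_vconsE; under eq_integral do rewrite -hE).
rewrite -(gaussian_plane_rotation cs mh)//.
apply: eq_integral => x _; apply: eq_integral => y _; rewrite hE.
by congr (gaussian R n _); apply/seteqP; split => v /=; rewrite rot2_vcons.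
Qed.

Lemma vconsP n (v : 'cV[R]_n.+1) : {x & {w | v = vcons x w}}.
Proof.
exists (v 0 0), (@dsubmx R 1 n 1 v).
have vE : @usubmx R 1 n 1 v = (v 0 0)%:M.
  apply/matrixP => i j; rewrite !ord1 !mxE eqxx mulr1n.
  by congr (v _ _); apply/val_inj.
by rewrite /vcons -vE; exact/esym/(@vsubmxK R 1 n 1).
Qed.

Lemma mulmx_ext m n (A B : 'M[R]_(m, n)) : (forall v : 'cV_n, A *m v = B *m v) ->
  A = B.
Proof.
move=> AB; apply/matrixP => i j; have := AB (delta_mx j 0).
by rewrite -!colE => /matrixP/(_ i 0); rewrite !mxE.
Qed.

Lemma ext1M n (P Q : 'M[R]_n) : ext1 P *m ext1 Q = ext1 (P *m Q).
Proof.
apply: mulmx_ext => v; have [x [w ->]] := vconsP v.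
by rewrite -mulmxA !ext1_vcons mulmxA.
Qed.

Lemma ext1_1 n : ext1 (1%:M : 'M[R]_n) = 1%:M.
Proof. exact: (esym (@scalar_mx_block _ 1 n 1)). Qed.

Lemma tr_ext1 n (Q : 'M[R]_n) : (ext1 Q)^T = ext1 Q^T.
Proof. by apply: etrans (tr_block_mx (1%:M : 'M[R]_1) 0 0 Q) _; rewrite trmx1 !trmx0. Qed.

Lemma tr_rot2 n (c s : R) : (rot2 n c s)^T = rot2 n c (- s).
Proof.
apply: (etrans (tr_block_mx (c%:M : 'M[R]_1) (row_mx (- s)%:M 0)
  (col_mx s%:M 0) (block_mx (c%:M : 'M[R]_1) 0 0 1%:M))).
by rewrite tr_row_mx tr_col_mx tr_block_mx !tr_scalar_mx !trmx0 /rot2 opprK.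
Qed.

Lemma rot2_orthogonal n (c s : R) : c ^+ 2 + s ^+ 2 = 1 ->
  (rot2 n c s)^T *m rot2 n c s = 1%:M.
Proof.
move=> cs; apply: mulmx_ext => v; rewrite tr_rot2 -mulmxA mul1mx.
have [x [w ->]] := vconsP v; have [y [{}w ->]] := vconsP w.
rewrite !rot2_vcons; congr vcons; last congr vcons.
  by rewrite -[RHS]mul1r -cs; ring.
by rewrite -[RHS]mul1r -cs; ring.
Qed.

(** The transpose of [Q] fixes the first basis vector as well, so both the first column and the
    first row of [Q] equal that vector. *)
Lemma orthogonal_fix_ext1 n (Q : 'M[R]_n.+1) : Q^T *m Q = 1%:M ->
  Q *m vcons 1 0 = vcons 1 0 -> exists2 Q', Q'^T *m Q' = 1%:M & Q = ext1 Q'.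
Proof.
move=> QQ Qe.
have QTe : Q^T *m vcons 1 0 = vcons 1 0 by rewrite -{1}Qe mulmxA QQ mul1mx.
pose q : 'M[R]_(1 + n) := Q.
have QE : Q = ext1 (drsubmx q).
  rewrite /ext1 -[LHS]/q -[LHS]submxK.
  have e0 (v : 'M[R]_(1 + n, 1 + n)) :
      v *m col_mx 1%:M 0 = col_mx (ulsubmx v) (dlsubmx v).
    by rewrite -{1}[v]submxK mul_block_col !mulmx1 !mulmx0 !addr0.
  have := e0 q; rewrite [LHS]Qe => /(@eq_col_mx _ 1 n 1)[<- <-].
  have := e0 q^T; rewrite [LHS]QTe => /(@eq_col_mx _ 1 n 1)[_].
  by rewrite -trmx_ursub => /(congr1 trmx); rewrite trmxK trmx0 => <-.
exists (drsubmx q) => //; move: QQ; rewrite QE tr_ext1 ext1M -ext1_1.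
by move=> /(@eq_block_mx _ 1 n 1 n)[].
Qed.

Lemma orthogonal_first_col n (u : 'cV[R]_n.+1) :
  exists2 Q : 'M[R]_n.+1, Q^T *m Q = 1%:M &
    Q *m vcons (Num.sqrt ((u^T *m u) 0 0)) 0 = u.
Proof.
have [->|u0] := eqVneq u 0.
  exists 1%:M; first by rewrite trmx1 mul1mx.
  rewrite mul1mx mulmx0 mxE sqrtr0 /vcons raddf0.
  exact: (@col_mx0 _ 1 n 1).
have s0 : Num.sqrt ((u^T *m u) 0 0) != 0.
  by rewrite gt_eqF// sqrtr_gt0 lt_def cV_sqr_ge0 cV_sqr_eq0 u0.
have [W' WW'] := @orthogonal_completion R 1 n _ (cV_normalize u0).
eexists; first exact: WW'.
apply: (etrans (@mul_row_col _ n.+1 1 n 1 _ _ _ _)); rewrite mulmx0 addr0 mul_mx_scalar.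
by rewrite scalerA mulfV// scale1r.
Qed.

(** Reflection on the line is the half turn of the plane, [c = -1] and [s = 0], applied to a
    function of the first coordinate. *)
Lemma normal_prob_oppr (f : T1 -> \bar R) : measurable_fun setT f ->
  (forall x, 0 <= f x)%E ->
  (\int[N01]_x f (- x)%R = \int[N01]_x f x)%E.
Proof.
move=> mf f0; have c1 : (-1) ^+ 2 + 0 ^+ 2 = 1 :> R by rewrite sqrrN expr1n expr0n addr0.
have mf1 : measurable_fun setT (fun p : T1 * T1 => f p.1) by exact: measurableT_comp.
have I (a : \bar R) : (\int[N01]_y cst a y)%E = a.
  by rewrite integral_cst// [X in (_ * X)%E]probability_setT mule1.
transitivity (\int[N01]_x \int[N01]_y f (-1 * x + - 0 * y)%R)%E.
  apply: eq_integral => x _; rewrite -[LHS]I.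
  by apply: eq_integral => y _; rewrite oppr0 mul0r addr0 mulN1r.
apply: etrans (gaussian_plane_rotation c1 mf1 (fun=> f0 _)) _.
by apply: eq_integral => x _; exact: (I (f x)).
Qed.

(* Induction on the dimension: every orthogonal Q is a product
   ext1 Q1 *m rot2 c s *m ext1 Q2 with Q1 and Q2 orthogonal. *)
Theorem gaussian_orthogonal n (Q : 'M[R]_n) :
  Q^T *m Q = 1%:M -> gaussian_invariant Q.
Proof.
elim: n Q => [|[_|n IH]] Q QQ.
- move=> A mA; congr (gaussian R 0 _).
  by apply/seteqP; split => v /=; rewrite [Q *m v]flatmx0 [v]flatmx0.
(* In dimension one there is no plane to rotate: [Q] is 1 or -1. *)
- move=> A mA; rewrite !gaussian_vconsE.
  have QE : Q = (Q 0 0)%:M by exact: mx11_scalar.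
  have c1 : Q 0 0 ^+ 2 = 1.
    by move/matrixP: QQ => /(_ 0 0); rewrite mxE big_ord1 !mxE eqxx mulr1n -expr2.
  have Qv x (v : 'cV[R]_0) : Q *m vcons x v = vcons (Q 0 0 * x) v.
    rewrite QE mul_scalar_mx [RHS]/vcons [v]flatmx0.
    apply: etrans (@scale_col_mx _ 1 0 1 _ _ _) _.
    by rewrite scaler0 scale_scalar_mx mxE eqxx mulr1n.
  transitivity (\int[N01]_x gaussian R 0 [set v | A (vcons (Q 0%R 0%R * x)%R v)])%E.
    apply: eq_integral => x _; congr (gaussian R 0 _).
    by apply/seteqP; split => v /=; rewrite Qv.
  move/eqP: c1; rewrite sqrf_eq1 => /orP[] /eqP ->.
    by under eq_integral do rewrite mul1r.
  under eq_integral do rewrite mulN1r.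
  pose B : set (T1 * 'cV[R]_0) := [set q | A (vcons q.1 q.2)].
  have mB : measurable B by exact: (measurable_preimageT (measurable_vcons (n := 0)) mA).
  have mh : measurable_fun setT (gaussian R 0 \o xsection B).
    exact: measurable_fun_xsection.
  have hE x : (gaussian R 0 \o xsection B) x = gaussian R 0 [set v | A (vcons x v)].
    by congr (gaussian R 0 _); apply/seteqP; split => v; rewrite /= xsectionE.
  under eq_integral do rewrite -hE.
  under [RHS]eq_integral do rewrite -hE.
  exact: normal_prob_oppr.
(* The first column of [Q] is [vcons c u]. With [s] the norm of [u], [rot2 n c s] sends the first
   basis vector to [vcons c (vcons s 0)], which [ext1 Q1] carries to [vcons c u]. So [P] and [Q]
   share their first column, and [P^T *m Q] fixes the first basis vector. *)
have [c [u Qe]] := vconsP (Q *m vcons 1 0).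
pose s := Num.sqrt ((u^T *m u) 0 0).
have tr_vcons m x (v : 'cV[R]_m) y w :
    ((vcons x v)^T *m vcons y w) 0 0 = x * y + (v^T *m w) 0 0.
  have -> : (vcons x v)^T *m vcons y w = x%:M^T *m y%:M + v^T *m w.
    apply: (etrans (congr1 (mulmx^~ _) (@tr_col_mx _ 1 m 1 _ _))).
    exact: mul_row_col.
  by rewrite tr_scalar_mx -scalar_mxM mxE mxE eqxx mulr1n.
have cs : c ^+ 2 + s ^+ 2 = 1.
  rewrite sqr_sqrtr ?cV_sqr_ge0// expr2 -tr_vcons -Qe trmx_mul -mulmxA.
  by rewrite (mulmxA Q^T) QQ mul1mx tr_vcons mulr1 mulmx0 mxE addr0.
have [Q1 Q1Q1 Q1u] := orthogonal_first_col u.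
pose P := ext1 Q1 *m rot2 n c s.
have PP : P^T *m P = 1%:M.
  rewrite /P trmx_mul mulmxA -(mulmxA _ _ (ext1 Q1)) tr_ext1 ext1M Q1Q1 ext1_1.
  by rewrite mulmx1 rot2_orthogonal.
have PP' : P *m P^T = 1%:M by exact: mulmx1C.
have Pe : P *m vcons 1 0 = Q *m vcons 1 0.
  have e2 : (0 : 'cV[R]_n.+1) = vcons 0 0.
    by rewrite /vcons raddf0; exact/esym/(@col_mx0 _ 1 n 1).
  rewrite Qe /P -mulmxA {1}e2 rot2_vcons !mulr1 !mulr0 !addr0.
  by rewrite ext1_vcons Q1u.
have Q'Q' : (P^T *m Q)^T *m (P^T *m Q) = 1%:M.
  by rewrite trmx_mul trmxK mulmxA -(mulmxA _ P) PP' mulmx1.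
have [|Q2 Q2Q2 Q'E] := orthogonal_fix_ext1 Q'Q'.
  by rewrite -mulmxA -Pe mulmxA PP mul1mx.
have -> : Q = P *m ext1 Q2 by rewrite -Q'E mulmxA PP' mul1mx.
apply: gaussian_invariantM.
  apply: gaussian_invariantM; first exact/gaussian_invariant_ext1/IH.
  exact: gaussian_invariant_rot2.
exact/gaussian_invariant_ext1/IH.
Qed.

End gaussian_invariance.

(** * Gaussian marginals, positivity on boxes, nullity of hyperplanes *)

Section gaussian_marginals.
Context (R : realType).
Local Notation T1 := (measurableTypeR R).
Local Notation N01 := (normal_prob (0 : R) 1).

Lemma usubmx_vcons r e (x : R) (v : 'cV[R]_(r + e)) :
  @usubmx R r.+1 e 1 (vcons x v) = vcons x (usubmx v).
Proof.
apply/matrixP => i j; rewrite !ord1 !mxE.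
case: splitP => k /= ik; case: splitP => l /= il; rewrite ?mxE ?ord1 ?eqxx//.
- by move: ik; rewrite il; case: k => -[].
- by move: il; rewrite ik; case: l => -[].
- by congr (v _ _); apply: val_inj => /=; apply/eqP; rewrite -(eqn_add2l 1) -ik il.
Qed.

Lemma gaussian_usubmx r e (A : set 'cV[R]_r) : measurable A ->
  gaussian R (r + e) [set v | A (usubmx v)] = gaussian R r A.
Proof.
elim: r A => [A _|r IH A mA].
  have [A0|nA0] := pselect (A 0).
    transitivity (1 : \bar R)%E; last first.
      rewrite -(probability_setT (gaussian R 0)); congr (gaussian R 0 _).
      by apply/seteqP; split => v // _; rewrite [v]flatmx0.
    rewrite -(probability_setT (gaussian R (0 + e))); congr (gaussian R (0 + e) _).
    by apply/seteqP; split => v // _ /=; rewrite [usubmx v]flatmx0.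
  transitivity (0 : \bar R)%E; last first.
    rewrite -(measure0 (gaussian R 0)); congr (gaussian R 0 _).
    by apply/seteqP; split => v //; rewrite [v]flatmx0.
  rewrite -(measure0 (gaussian R (0 + e))); congr (gaussian R (0 + e) _).
  by apply/seteqP; split => v //=; rewrite [usubmx v]flatmx0.
rewrite [LHS](@gaussian_vconsE R (r + e)) gaussian_vconsE; apply: eq_integral => x _.
rewrite -IH; last exact: (measurable_preimageT (measurable_vconsr x)).
by congr (gaussian R (r + e) _); apply/seteqP; split => v /=; rewrite usubmx_vcons.
Qed.

(** For an orthogonal completion of [W], [W^T *m x] is the first block of the rotated vector. *)
Lemma gaussian_orthonormal d r (W : 'M[R]_(d, r)) (A : set 'cV[R]_r) :
  (r <= d)%N -> W^T *m W = 1%:M -> measurable A ->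
  gaussian R d [set x | A (W^T *m x)] = gaussian R r A.
Proof.
move=> rd; move: W; rewrite -(subnKC rd) => W WW mA.
have [W' WW'] := orthogonal_completion WW.
have mA' : measurable [set v : 'cV[R]_(r + (d - r)) | A (usubmx v)].
  by apply: measurable_preimageT mA; exact: measurable_usubmx.
rewrite -[RHS](gaussian_usubmx (d - r))//.
have QQ : (row_mx W W')^T^T *m (row_mx W W')^T = 1%:M.
  by rewrite trmxK; exact: mulmx1C.
apply: etrans (gaussian_orthogonal QQ mA'); congr (gaussian _ _ _).
by apply/seteqP; split => v /=; rewrite tr_row_mx mul_col_mx col_mxKu.
Qed.

(** In the orthonormal coordinates [z = Q *m vcons t w] with first axis [v], the event for [A]
    depends on [t] alone and the event for [B] on [w] alone. *)
Lemma gaussian_line_independent r (v : 'cV[R]_r) (A : set R) (B : set 'cV[R]_r) :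
  v^T *m v = 1%:M -> measurable A -> measurable B ->
  (gaussian R r [set z | A ((v^T *m z) 0 0)%R /\ B (z - v *m (v^T *m z))%R] =
   gaussian R r [set z | A ((v^T *m z) 0 0)%R] *
   gaussian R r [set z | B (z - v *m (v^T *m z))%R])%E.
Proof.
case: r v B => [|r] v B vv mA mB.
  move/matrixP/(_ 0 0): vv => /eqP; rewrite [v]flatmx0 mulmx0 !mxE eqxx mulr1n.
  by rewrite eq_sym oner_eq0.
have [W' WW'] := @orthogonal_completion R 1 r v vv.
pose Q : 'M[R]_r.+1 := row_mx v W'.
have vW' : v^T *m W' = 0.
  move: WW'; rewrite tr_row_mx mul_col_row (scalar_mx_block 1 r).
  by move=> /(@eq_block_mx _ 1 r 1 r)[].
have Qt t w : Q *m vcons t w = t *: v + W' *m w.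
  apply: (etrans (@mul_row_col _ r.+1 1 r 1 _ _ _ _)).
  by rewrite mul_mx_scalar.
have vQ t w : v^T *m (Q *m vcons t w) = t%:M.
  by rewrite Qt mulmxDr -scalemxAr vv mulmxA vW' mul0mx addr0 scale_scalar_mx mulr1.
have zQ t w : Q *m vcons t w - v *m (v^T *m (Q *m vcons t w)) = W' *m w.
  by rewrite vQ Qt mul_mx_scalar addrAC subrr add0r.
have mv : measurable_fun setT (fun z : 'cV[R]_r.+1 => (v^T *m z) 0 0).
  by have /measurable_mxP := measurable_mulmxl v^T; exact.
have mz : measurable_fun setT (fun z : 'cV[R]_r.+1 => z - v *m (v^T *m z)).
  have := measurable_mulmxl (1%:M - v *m v^T).
  by under eq_fun do rewrite mulmxBl mul1mx -mulmxA.
have E (A' : set R) (B' : set 'cV[R]_r.+1) : measurable A' -> measurable B' ->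
    gaussian R r.+1 [set z | A' ((v^T *m z) 0 0)%R /\ B' (z - v *m (v^T *m z))%R] =
    (N01 A' * gaussian R r [set w | B' (W' *m w)%R])%E.
  move=> mA' mB'.
  have mE : measurable [set z | A' ((v^T *m z) 0 0)%R /\ B' (z - v *m (v^T *m z))%R].
    apply: measurableI; first exact: (measurable_preimageT mv).
    exact: (measurable_preimageT mz).
  rewrite -(gaussian_orthogonal WW' mE) gaussian_vcons -product_measure1E//.
    congr (_ _); apply/seteqP; split => -[t w] /=; rewrite -/Q zQ vQ !mxE eqxx mulr1n //.
  exact: (measurable_preimageT (measurable_mulmxl W')).
rewrite E//.
have EA : gaussian R r.+1 [set z | A ((v^T *m z) 0 0)%R] = N01 A.
  transitivity (N01 A * gaussian R r setT)%E.
    apply: etrans (E A setT mA measurableT); congr (gaussian _ _ _).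
    by apply/seteqP; split => z //= -[].
  by rewrite [X in (_ * X)%E]probability_setT mule1.
have EB : gaussian R r.+1 [set z | B (z - v *m (v^T *m z))%R] =
    gaussian R r [set w | B (W' *m w)%R].
  transitivity (N01 setT * gaussian R r [set w | B (W' *m w)%R])%E.
    apply: etrans (E setT B measurableT mB); congr (gaussian _ _ _).
    by apply/seteqP; split => z //= -[].
  by rewrite [X in (X * _)%E]probability_setT mul1e.
by rewrite EA EB.
Qed.

Lemma normal_prob_ball_gt0 (z d : R) : 0 < d ->
  (0 < N01 [set x | `|x - z| < d]%R)%E.
Proof.
move=> d0; rewrite (_ : mkset _ = `]z - d, z + d[%classic); last first.
  by apply/seteqP; split => x /=; rewrite in_itv/= ltr_distl.
(* The density at distance [|z| + d] from 0, hence a lower bound for it on the whole interval. *)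
pose m : R := normal_peak 1 * expR (- (`|z| + d) ^+ 2 / (1 ^+ 2 *+ 2)).
have m0 : 0 < m by rewrite mulr_gt0 ?expR_gt0// normal_peak_gt0 ?oner_neq0.
apply: (@lt_le_trans _ _
    (\int[lebesgue_measure]_(x in `](z - d)%R, (z + d)%R[%classic) m%:E)%E).
  rewrite integral_cst//= lebesgue_measure_itv/= lte_fin.
  by rewrite ltrD2l gtrN// -EFinB -EFinM lte_fin mulr_gt0// subr_gt0 ltrD2l gtrN.
apply: ge0_le_integral => //=.
- by move=> x _; rewrite lee_fin ltW.
- by apply/measurable_EFinP/measurable_funTS; exact: measurable_normal_pdf.
- move=> x; rewrite in_itv/= -ltr_distl => xz.
  rewrite lee_fin normal_pdfE ?oner_neq0// /normal_fun ler_pM2l; last first.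
    by rewrite normal_peak_gt0 ?oner_neq0.
  rewrite ler_expR !mulNr lerN2 ler_pM2r ?invr_gt0 ?pmulrn_rgt0// ?exprn_gt0//.
  have xz' : `|x| <= `|z| + d.
    by rewrite -[x in `|x|](subrK z) (le_trans (ler_normD _ _))// addrC lerD2l ltW.
  by rewrite subr0 -[leLHS]real_normK ?num_real// lerXn2r// nnegrE addr_ge0// ltW.
Qed.

Lemma gaussian_box_gt0 n (z : 'cV[R]_n) (d : R) : 0 < d ->
  (0 < gaussian R n [set w | forall i, `|w i 0 - z i 0| < d]%R)%E.
Proof.
move=> d0; pose B (i : 'I_n) : set T1 := [set x | `|x - z i 0| < d].
have mB i : measurable (B i).
  rewrite (_ : B i = `]z i 0 - d, z i 0 + d[%classic)//.
  by apply/seteqP; split => x /=; rewrite /B/= in_itv/= ltr_distl.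
have -> : gaussian R n [set w | forall i, `|w i 0 - z i 0| < d] =
    (\prod_(i < n) N01 (B i))%E.
  rewrite -(iid_law_box _ mB); congr (iid_law _ _ _).
  by apply/seteqP; split => t h i /=; have := h i; rewrite /B/= mxE.
apply: (big_ind (fun x => 0 < x)%E) => //; first by move=> x y; exact: mule_gt0.
by move=> i _; exact: normal_prob_ball_gt0.
Qed.

(** The normalized linear form is standard normal, by [gaussian_orthonormal] with a single column,
    and a normal law has no atoms. *)
Lemma gaussian_hyperplane0 n (a : 'cV[R]_n) (b : R) : (a != 0) || (b != 0) ->
  gaussian R n [set x | (a^T *m x) 0 0 + b = 0] = 0%E.
Proof.
have [-> /= b0|a0 _] := eqVneq a 0.
  rewrite (_ : mkset _ = set0) ?measure0//; apply/seteqP; split => x //=.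
  by rewrite trmx0 mul0mx mxE add0r => /eqP; rewrite (negbTE b0).
pose s := Num.sqrt ((a^T *m a) 0 0).
have s0 : s != 0 by rewrite gt_eqF// sqrtr_gt0 lt_def cV_sqr_ge0 cV_sqr_eq0 a0.
have n0 : (0 < n)%N by case: n a a0 {s s0} => // a; rewrite [a]flatmx0 eqxx.
pose A : set 'cV[R]_1 := [set t | t 0 0 = - b / s].
have mA : measurable A.
  apply: (@measurable_preimageT _ _ _ _ (fun t : 'cV[R]_1 => t 0 0) [set - b / s]).
    exact: measurable_mx_entry.
  exact: measurable_set1.
have sE x : ((s^-1 *: a)^T *m x) 0 0 = s^-1 * (a^T *m x) 0 0.
  by rewrite [(_ *: a)^T]linearZ/= -scalemxAl [LHS]mxE.
rewrite (_ : mkset _ = [set x | A ((s^-1 *: a)^T *m x)]); last first.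
  apply/seteqP; split => x; rewrite /A/= sE.
    by move=> /eqP; rewrite addr_eq0 => /eqP ->; rewrite mulrC.
  move=> /(congr1 ( *%R s)); rewrite mulVKf// mulrC mulfVK// => ->.
  by rewrite addNr.
rewrite gaussian_orthonormal//; last exact: cV_normalize.
rewrite gaussian_vcons (_ : mkset _ = [set - b / s] `*` setT); last first.
  apply/seteqP; split => -[t w]; rewrite /A/= !mxE.
    by case: splitP => // k _; rewrite !mxE ord1 eqxx mulr1n.
  by move=> [-> _]; case: splitP => // k _; rewrite !mxE ord1 eqxx mulr1n.
rewrite product_measure1E//.
rewrite [X in (X * _)%E](_ : _ = 0%E) ?mul0e//.
have /null_content_dominatesP := normal_prob_dominates (0 : R) 1; apply => //.
exact: lebesgue_measure_set1.
Qed.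

End gaussian_marginals.

(** * Affine pieces of ReLU networks *)

Section relu_network_regularity.
Context (R : realType).

(** Coordinatewise ReLU acts at [x] as the 0/1 diagonal matrix of the set of nonnegative
    coordinates, and composition pairs the two lists. Only the list of affine maps is kept, without
    the regions where they are valid. *)
Lemma relu_network_piecewise m n (f : 'cV[R]_m -> 'cV[R]_n) : relu_network f ->
  exists s : seq ('M[R]_(n, m) * 'cV[R]_n),
    forall x, exists2 p, p \in s & f x = p.1 *m x + p.2.
Proof.
elim=> {m n f} [m n A b|n|m n p g f _ [s hs] _ [t ht]].
- by exists [:: (A, b)] => x; exists (A, b); rewrite ?mem_head.
- pose F (J : {set 'I_n}) : 'M[R]_n * 'cV[R]_n :=
    (diag_mx (\row_i (i \in J)%:R), 0).
  exists (map F (enum {: {set 'I_n}})) => x.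
  exists (F (finset (fun i => 0 <= x i 0))); first by rewrite map_f// mem_enum.
  apply/matrixP => i j; rewrite ord1 /= addr0 mul_diag_mx !mxE inE.
  by rewrite maxC; case: leP; rewrite ?mul1r ?mul0r.
- exists [seq (q.1 *m p.1, q.1 *m p.2 + q.2) | q <- s, p <- t] => x /=.
  have [p1 p1t fx] := ht x; have [q qs gfx] := hs (f x).
  exists (q.1 *m p1.1, q.1 *m p1.2 + q.2).
    exact: (allpairs_f (fun q p => (q.1 *m p.1, q.1 *m p.2 + q.2))).
  by rewrite gfx fx mulmxDr mulmxA addrA.
Qed.

Lemma measurable_relu_network m n (f : 'cV[R]_m -> 'cV[R]_n) :
  relu_network f -> measurable_fun setT f.
Proof.
elim=> {m n f} [m n A b|n|m n p g f _ mg _ mf].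
- by apply: measurable_addmx; [exact: measurable_mulmxl|exact: measurable_cst].
- apply/measurable_mxP => i j; under eq_fun do rewrite mxE.
  by apply: measurable_maxr => //; exact: measurable_mx_entry.
- exact: measurableT_comp.
Qed.

(** A Lipschitz bound for the sup norm, phrased with a coordinatewise bound [e] so that it composes
    directly. For an affine layer, the sum of all entries in absolute value bounds every row sum at
    once. *)
Lemma relu_network_lipschitz m n (f : 'cV[R]_m -> 'cV[R]_n) : relu_network f ->
  exists2 L : R, 0 <= L & forall (x y : 'cV[R]_m) (e : R), (forall j, `|x j 0 - y j 0| <= e) ->
    0 <= e -> forall i, `|f x i 0 - f y i 0| <= L * e.
Proof.
elim=> {m n f} [m n A b|n|m n p g f _ [L L0 hL] _ [M M0 hM]].
- exists (\sum_i \sum_j `|A i j|); first by do 2 apply: sumr_ge0 => ? _.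
  move=> x y e xy e0 i; rewrite [(A *m x + b) _ _]mxE [(A *m y + b) _ _]mxE.
  rewrite opprD addrACA subrr addr0 !mxE -sumrB (le_trans (ler_norm_sum _ _ _))//.
  rewrite (bigD1 i)//= mulrDl -[leLHS]addr0 lerD//; last first.
    by rewrite mulr_ge0// sumr_ge0// => k _; rewrite sumr_ge0.
  rewrite mulr_suml ler_sum// => j _.
  by rewrite -mulrBr normrM ler_wpM2l.
- exists 1 => // x y e xy e0 i; rewrite !mxE mul1r (le_trans _ (xy i))//.
  move: (x i 0) (y i 0) => a b; rewrite ler_norml.
  have := ler_norm (a - b); have := ler_norm (b - a); rewrite -normrN opprB.
  by move: `|a - b| => N; have [] := leP a 0; have [] := leP b 0; lra.
- exists (L * M); first exact: mulr_ge0.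
  move=> x y e xy e0 i; rewrite -mulrA; apply: hL; last exact: mulr_ge0.
  by move=> j; exact: hM.
Qed.

(** Distinct values in [s] differ by at least some [h > 0]. Cut into [k] equal steps, the way from 0
    to [t] changes [g] by less than [h] at each step, hence not at all. *)
Lemma lipschitz_finite_range_cst (g : R -> R) (L : R) (s : seq R) :
  (forall t u, `|g t - g u| <= L * `|t - u|) -> (forall t, g t \in s) ->
  forall t, g t = g 0.
Proof.
move=> gL gs t.
have [h h0 hs] : exists2 h : R, 0 < h &
    forall d, d \in [seq a - b | a <- s, b <- s] -> d != 0 -> h <= `|d|.
  elim: [seq a - b | a <- s, b <- s] => [|d D [h h0 hD]]; first by exists 1.
  have [->|d0] := eqVneq d 0.
    by exists h => // x; rewrite inE => /predU1P[->|/hD//]; rewrite eqxx.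
  exists (Num.min h `|d|); first by rewrite lt_min h0 normr_gt0.
  move=> x; rewrite inE => /predU1P[->|xD x0].
    by rewrite ge_min lexx orbT.
  by rewrite ge_min hD.
pose k := (Num.truncn (L * `|t| / h)).+1.
have kL : L * (`|t| / k%:R) < h.
  rewrite mulrA ltr_pdivrMr ?ltr0n// [h * _]mulrC -ltr_pdivrMr//.
  by rewrite /k; exact: truncnS_gt.
suff H j : g (t * (j%:R / k%:R)) = g 0.
  by rewrite -[in LHS](mulr1 t) -(@divff _ k%:R) ?H// pnatr_eq0.
elim: j => [|j IH]; first by rewrite mul0r mulr0.
rewrite -IH; apply/eqP/negP => /negP; rewrite -subr_eq0 => /hs.
rewrite (allpairs_f (fun a b => a - b))// => /(_ isT); apply/negP; rewrite -ltNge.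
apply: le_lt_trans kL; rewrite (le_trans (gL _ _))// -mulrBr -mulrBl -natr1.
by rewrite addrAC subrr add0r mul1r normrM normfV [ `|k%:R| ]ger0_norm.
Qed.

End relu_network_regularity.

(** * Pieces of positive probability and their slopes *)

Section active_pieces.
Context (R : realType).

Lemma orth_proj_unique n (S : {vspace 'cV[R]_n}) (z p : 'cV[R]_n) : p \in S ->
  (forall u, u \in S -> u^T *m (z - p) = 0) -> orth_proj S z = p.
Proof.
move=> pS zp; apply/eqP; rewrite -subr_eq0; apply/eqP.
have : orth_proj S z - p \in (S :&: orth_compl S)%VS.
  rewrite memv_cap memvB ?orth_proj_mem//=.
  rewrite (_ : _ - _ = (z - p) - (z - orth_proj S z)); last by rewrite opprB [RHS]addrC addrA subrK.
  by rewrite memvB ?orth_proj_compl//; apply/memv_orth_compl.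
by rewrite capv_orth_compl memv0 => /eqP.
Qed.

(** The full coincidence set: it may be disconnected, and different pieces may overlap. *)
Definition affine_piece r (sigma : 'cV[R]_r -> R) (p : 'cV[R]_r * R) : set 'cV[R]_r :=
  [set z | sigma z = (p.1^T *m z) 0 0 + p.2].

Lemma measurable_affine_form r (p : 'cV[R]_r * R) :
  measurable_fun setT (fun z : 'cV[R]_r => (p.1^T *m z) 0 0 + p.2).
Proof.
apply: measurable_funD => //.
by have /measurable_mxP := measurable_mulmxl p.1^T; exact.
Qed.

Lemma measurable_affine_piece r (sigma : 'cV[R]_r -> R) p :
  measurable_fun setT sigma -> measurable (affine_piece sigma p).
Proof.
move=> msigma; rewrite (_ : affine_piece _ _ =
  (fun z => sigma z == (p.1^T *m z) 0 0 + p.2) @^-1` [set true]).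
  apply: measurable_preimageT => //; apply: measurable_fun_eqr => //.
  exact: measurable_affine_form.
by apply/seteqP; split => z /= /eqP.
Qed.

Section scalar_network.
Context (r : nat) (sigma : 'cV[R]_r -> R).
Hypothesis net : scalar_relu_network sigma.

Lemma scalar_relu_piecewise : exists s : seq ('cV[R]_r * R),
  forall z, exists2 p, p \in s & affine_piece sigma p z.
Proof.
have [f /relu_network_piecewise[s hs] sf] := net.
pose F (q : 'M[R]_(1, r) * 'cV[R]_1) := (q.1^T, q.2 0 0).
exists (map F s) => z; have [q qs fq] := hs z.
exists (F q); first exact: map_f.
by rewrite /affine_piece/= sf fq trmxK mxE.
Qed.

Lemma measurable_scalar_relu : measurable_fun setT sigma.
Proof.
have [f /measurable_relu_network/measurable_mxP mf /funext ->] := net.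
exact: mf.
Qed.

Lemma scalar_relu_lipschitz : exists2 L : R, 0 <= L &
  forall (x y : 'cV[R]_r) (e : R), (forall j, `|x j 0 - y j 0| <= e) -> 0 <= e ->
  `|sigma x - sigma y| <= L * e.
Proof.
have [f /relu_network_lipschitz[L L0 hL] sf] := net.
by exists L => // x y e xy e0; rewrite !sf; exact: hL.
Qed.

Let active p := (0 < gaussian R r (affine_piece sigma p))%E.

(* The complement of the active pieces is open, and it is covered by finitely
   many null sets. *)
Lemma active_pieces_cover : exists s : seq ('cV[R]_r * R),
  (forall z, exists2 p, p \in s & affine_piece sigma p z) /\
  (forall p, p \in s -> active p).
Proof.
have [s hs] := scalar_relu_piecewise; have [L L0 hL] := scalar_relu_lipschitz.
exists [seq p <- s | active p]; split; last first.
  by move=> p; rewrite mem_filter => /andP[].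
move=> z; apply: contrapT => nz.
have {}nz p : p \in [seq p <- s | active p] -> ~ affine_piece sigma p z.
  by move=> ps pz; apply: nz; exists p.
have [e e0 he] : exists2 e : R, 0 < e & forall p, p \in [seq p <- s | active p] ->
    forall w : 'cV[R]_r, (forall i, `|w i 0 - z i 0| < e) -> ~ affine_piece sigma p w.
  elim: [seq p <- s | active p] nz => [|p t IH] nz; first by exists 1.
  have [|e e0 he] := IH; first by move=> q qt; apply: nz; rewrite inE qt orbT.
  (* [M] is a Lipschitz constant of [sigma] minus the affine function of [p], and [g] is the size of
     this difference at [z]. Within [g / (M + 1)] of [z] the difference moves by less than [g], so
     it cannot vanish. *)
  pose M := L + \sum_i `|p.1 i 0|.
  have M0 : 0 <= M by rewrite addr_ge0// sumr_ge0.
  pose g := `|sigma z - ((p.1^T *m z) 0 0 + p.2)|.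
  have g0 : 0 < g.
    by rewrite normr_gt0 subr_eq0; apply/eqP/nz; rewrite mem_head.
  have e'0 : 0 < g / (M + 1) by rewrite divr_gt0// ltr_wpDl.
  exists (Num.min e (g / (M + 1))); first by rewrite lt_min e0.
  move=> q; rewrite inE => /predU1P[->|qt] w wz; last first.
    by apply: (he q qt) => i; rewrite (lt_le_trans (wz i))// ge_min lexx.
  move=> pw; have {}wz i : `|z i 0 - w i 0| <= g / (M + 1).
    by rewrite distrC ltW// (lt_le_trans (wz i))// ge_min lexx orbT.
  have : g <= M * (g / (M + 1)).
    have gE : g = `|(sigma z - sigma w) - (p.1^T *m (z - w)) 0 0|.
      have -> : (p.1^T *m (z - w)) 0 0 = (p.1^T *m z) 0 0 - (p.1^T *m w) 0 0.
        by rewrite mulmxBr !mxE.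
      by rewrite /g pw; congr `|_|; ring.
    rewrite [leLHS]gE (le_trans (ler_normB _ _))// mulrDl lerD//.
      exact: (hL _ _ _ wz (ltW e'0)).
    rewrite mxE (le_trans (ler_norm_sum _ _ _))// mulr_suml ler_sum// => i _.
    by rewrite !mxE normrM ler_wpM2l.
  rewrite leNgt => /negP; apply; rewrite mulrCA -ltr_pdivlMl// mulVf ?gt_eqF//.
  by rewrite ltr_pdivrMr ?mul1r ?ltrDl// ltr_wpDl.
pose idle := [seq p <- s | ~~ active p].
have mpiece p : p \in idle -> measurable (affine_piece sigma p).
  by move=> _; exact: (measurable_affine_piece p measurable_scalar_relu).
have null : (gaussian R r [set w | exists2 p, p \in idle & affine_piece sigma p w] <= 0)%E.
  apply: le_trans (measure_exists_seq_le (gaussian R r) mpiece) _.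
  rewrite big_seq big1// => p; rewrite mem_filter -leNgt => /andP[p0 _].
  by apply/eqP; rewrite eq_le p0 measure_ge0.
have := gaussian_box_gt0 z e0; rewrite ltNge => /negP; apply.
apply: le_trans null; apply: le_measure; rewrite ?inE//.
- rewrite (_ : mkset _ = \bigcap_(i in [set: 'I_r]) [set w | `|w i 0 - z i 0| < e]); last first.
    by apply/seteqP; split => w h i //=; exact: h.
  apply: fin_bigcap_measurable => // i _.
  apply: (@measurable_preimageT _ _ _ _
    (fun w : 'cV[R]_r => `|w i 0 - z i 0| < e) [set true]) => //.
  apply: measurable_fun_ltr => //; apply: measurableT_comp => //.
  by apply: measurable_funB => //; exact: measurable_mx_entry.
- exact: measurable_exists_seq.
- move=> w wz; have [p ps pw] := hs w; exists p => //.
  by rewrite mem_filter ps andbT; apply/negP => ap; apply: he wz pw; rewrite mem_filter ap.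
Qed.

Hypothesis full : full_intrinsic_dimension sigma.

Lemma pieces_span (s : seq ('cV[R]_r * R)) :
  (forall z, exists2 p, p \in s & affine_piece sigma p z) ->
  <<[seq p.1 | p <- s]>>%VS = fullv.
Proof.
move=> hs; apply: contrapT => /eqP Sfull; apply: full.
set S := <<_>>%VS in Sfull.
have : orth_compl S != 0%VS.
  apply: contra Sfull => /eqP S0; have := dim_orth_compl S.
  by rewrite S0 dimv0 addn0 => dS; rewrite eqEdim subvf dimvf /dim/= muln1 dS.
rewrite -vpick0; set u := vpick _ => u0.
pose v := (Num.sqrt ((u^T *m u) 0 0))^-1 *: u.
have vv : v^T *m v = 1%:M by exact: cV_normalize.
have pv p : p \in s -> p.1^T *m v = 0.
  move=> ps; have /memv_orth_compl := memv_pick (orth_compl S).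
  by move=> /(_ p.1) h; rewrite -scalemxAr h ?scaler0// memv_span// map_f.
move: v vv pv => v vv pv.
(* All slopes are orthogonal to [v], so on the line through [z] each affine function keeps its value
   at [z], and [sigma] takes values in that finite list. *)
have sv t z : sigma (z + t *: v) = sigma z.
  have [L L0 hL] := scalar_relu_lipschitz.
  pose g t := sigma (z + t *: v).
  pose M := L * \sum_i `|v i 0|.
  have -> : sigma z = g 0 by rewrite /g scale0r addr0.
  apply: (@lipschitz_finite_range_cst _ _ M [seq (p.1^T *m z) 0 0 + p.2 | p <- s]).
    move=> a b; rewrite /M -mulrA; apply: hL; last by rewrite mulr_ge0// sumr_ge0.
    move=> j.
    have vj k : (z + k *: v) j 0 = z j 0 + k * v j 0.
      by rewrite [LHS]mxE; congr (_ + _); exact: mxE.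
    rewrite !vj opprD addrACA subrr add0r -mulrBl normrM mulrC.
    by rewrite ler_wpM2r// (bigD1 j)//= lerDl sumr_ge0.
  move=> a; have [p ps pz] := hs (z + a *: v); apply/mapP; exists p => //.
  by rewrite [LHS]pz mulmxDr -scalemxAr pv// scaler0 addr0.
(* The hyperplane [T] is the proper subspace that contradicts [full]; its complement is the line of
   [v]. *)
pose T := orth_compl <[v]>%VS.
have vT w : w \in T -> v^T *m w = 0 by move=> /memv_orth_compl; apply; exact: memv_line.
have Tv w : w \in T -> w^T *m v = 0.
  by move=> /vT wv; rewrite -[LHS]trmxK trmx_mul trmxK wv trmx0.
have zT z : z - v *m (v^T *m z) \in T.
  apply/memv_orth_compl => _ /vlineP[k ->].
  rewrite [(_ *: v)^T]linearZ/= -scalemxAl mulmxBr [v^T *m (v *m _)]mulmxA vv.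
  by rewrite mul1mx subrr scaler0.
have vT' z : v *m (v^T *m z) \in orth_compl T.
  by apply/memv_orth_compl => w wT; rewrite mulmxA Tv// mul0mx.
have projT z : orth_proj T z = z - v *m (v^T *m z).
  apply: orth_proj_unique => // w wT; rewrite opprB addrC subrK.
  by move/memv_orth_compl : (vT' z); exact.
have projT' z : orth_proj (orth_compl T) z = v *m (v^T *m z).
  apply: orth_proj_unique => // w /memv_orth_compl wT.
  by rewrite -[LHS]trmxK trmx_mul trmxK wT ?trmx0.
exists T; split.
  move=> Tfull; have : v \in T by rewrite Tfull memvf.
  move=> /vT; rewrite vv => /matrixP/(_ 0 0)/eqP.
  by rewrite !mxE eqxx mulr1n oner_eq0.
move=> A B mA mB.
pose A' : set R := [set t | A (t *: v)].
pose B' : set 'cV[R]_r := [set z | B (z, sigma z)].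
have mA' : measurable A'.
  have mf : measurable_fun setT (fun t : R => t *: v).
    by apply: measurable_scalemx; [exact: measurable_id|exact: measurable_cst].
  exact: (measurable_preimageT mf).
have mB' : measurable B'.
  have mf : measurable_fun setT (fun z : 'cV[R]_r => (z, sigma z)).
    by apply: measurable_fun_pair; [exact: measurable_id|exact: measurable_scalar_relu].
  exact: (measurable_preimageT mf).
have vE z : v *m (v^T *m z) = (v^T *m z) 0 0 *: v.
  by rewrite {1}[v^T *m z]mx11_scalar mul_mx_scalar.
(* [sigma] factors through the projection onto [T], so an event on the pair of this projection and
   the label is an event on the projection alone. *)
have sE z : sigma (z - v *m (v^T *m z)) = sigma z.
  by rewrite vE -scaleNr sv.
have EA : (fun z => orth_proj (orth_compl T) z) @^-1` A =
    [set z | A' ((v^T *m z) 0 0)].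
  by apply/seteqP; split => z /=; rewrite /A'/= projT' vE.
have EB : (fun z => (orth_proj T z, sigma z)) @^-1` B =
    [set z | B' (z - v *m (v^T *m z))].
  by apply/seteqP; split => z /=; rewrite /B'/= projT sE.
by rewrite EA EB; exact: gaussian_line_independent.
Qed.

End scalar_network.

End active_pieces.

(** * Random samples *)

Section gram_matrices.
Context (R : realType) (D : nat).

(** The second moment matrix, of size [D] whatever the length of [s]. It is invertible exactly when
    [s] spans, and it is also the matrix of the normal equations of least squares. *)
Definition gram (s : seq 'cV[R]_D) : 'M[R]_D := \sum_(v <- s) v *m v^T.

Lemma gram_eq0 (s : seq 'cV[R]_D) (u : 'cV[R]_D) :
  gram s *m u = 0 -> forall v, v \in s -> u^T *m v = 0.
Proof.
move=> su v vs.
have : (u^T *m (gram s *m u)) 0 0 = \sum_(w <- s) (u^T *m w) 0 0 ^+ 2.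
  rewrite /gram mulmx_suml mulmx_sumr summxE; apply: eq_bigr => w _.
  have -> : u^T *m (w *m w^T *m u) = (u^T *m w) *m (u^T *m w)^T.
    by rewrite trmx_mul trmxK !mulmxA.
  by rewrite mxE big_ord1 [(_^T) 0 0]mxE expr2.
rewrite su mulmx0 [LHS]mxE => /esym/eqP.
rewrite psumr_eq0 => [/allP/(_ v vs)|w _]; last exact: sqr_ge0.
by rewrite implyTb sqrf_eq0 => /eqP uv; apply/matrixP => i j; rewrite !ord1 uv mxE.
Qed.

Lemma det_gram_neq0 (s : seq 'cV[R]_D) :
  reflect (forall u : 'cV[R]_D, (forall v, v \in s -> u^T *m v = 0) -> u = 0) (\det (gram s) != 0).
Proof.
apply: (iffP idP) => [sU u us|h].
  have gu : gram s *m u = 0.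
    rewrite mulmx_suml big_seq big1// => v vs.
    by rewrite -mulmxA -[v^T *m u]trmxK trmx_mul trmxK us// trmx0 mulmx0.
  have gU : gram s \in unitmx by rewrite unitmxE unitfE.
  by rewrite -[u](mulKmx gU) gu mulmx0.
apply: contraT; rewrite negbK => /det0P[w w0 wg].
have gs : (gram s)^T = gram s.
  by rewrite [LHS]linear_sum/=; apply: eq_bigr => v _; rewrite trmx_mul trmxK.
suff : w^T = 0 by move/eqP; rewrite trmx_eq0 (negbTE w0).
apply: h; apply: gram_eq0; apply: trmx_inj.
by rewrite trmx_mul gs trmxK wg trmx0.
Qed.

Lemma det_gram_span (s : seq 'cV[R]_D) :
  (D <= \dim (span s))%N -> \det (gram s) != 0.
Proof.
move=> Ds; apply/det_gram_neq0 => u us.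
have sT : (span s) = fullv.
  by apply/eqP; rewrite eqEdim subvf dimvf /dim/= muln1.
have uS : u \in orth_compl fullv.
  apply/memv_orth_compl => w; rewrite -sT => ws.
  rewrite (coord_span (X := in_tuple s) ws) linear_sum/= mulmx_suml big1// => i _.
  rewrite linearZ/= -scalemxAl.
  by rewrite -[_ *m u]trmxK trmx_mul trmxK us ?trmx0 ?scaler0// mem_nth.
apply/eqP; rewrite -memv0 -(capv_orth_compl fullv) memv_cap memvf.
exact: uS.
Qed.

End gram_matrices.

(** * General position of i.i.d. samples *)

Section iid_law_cons.
Context (R : realType) d (T : measurableType d) (P : probability T R).

Lemma iid_law_consE n (E : set (n.+1.-tuple T)) :
  iid_law P n.+1 E = (\int[P]_x iid_law P n [set t | E (tuple_cons (x, t))])%E.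
Proof.
apply: eq_integral => x _ /=; congr (iid_law P n _).
by apply/seteqP; split => t /=; rewrite xsectionE.
Qed.

Lemma measurable_iid_law_section n (E : set (n.+1.-tuple T)) : measurable E ->
  measurable_fun setT (fun x => iid_law P n [set t | E (tuple_cons (x, t))]).
Proof.
move=> mE; have mC : measurable ((@tuple_cons d T n) @^-1` E).
  exact: (measurable_preimageT (@measurable_tuple_cons _ _ _)).
have := measurable_fun_xsection (iid_law P n) mC.
congr (measurable_fun _ _); apply/funext => x /=; congr (iid_law P n _).
by apply/seteqP; split => t /=; rewrite xsectionE.
Qed.

End iid_law_cons.

Section general_position.
Context (R : realType) d (T : measurableType d) (P : probability T R).
Context (D : nat) (phi : T -> 'cV[R]_D).
Hypothesis mphi : measurable_fun setT phi.
Hypothesis phi_hyperplane :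
  forall u : 'cV[R]_D, u != 0 -> P [set x | u^T *m phi x = 0] = 0%E.

Definition sample_gram n (a : pred 'I_n) (t : n.-tuple T) : 'M[R]_D :=
  \sum_(i | a i) phi (tnth t i) *m (phi (tnth t i))^T.

Lemma measurable_sample_gram n (a : pred 'I_n) :
  measurable_fun setT (sample_gram a).
Proof.
apply: measurable_summx => i _.
have mi : measurable_fun setT (fun t : n.-tuple T => phi (tnth t i)).
  by apply: measurableT_comp => //; exact: measurable_tnth.
by apply: measurable_mulmx => //; exact: measurable_trmx.
Qed.

Lemma measurable_sample_gram_null n (s : seq 'cV[R]_D) (a : pred 'I_n) :
  measurable [set t | \det (gram s + sample_gram a t) = 0].
Proof.
have mG : measurable_fun setT (fun t => \det (gram s + sample_gram a t)).
  apply: measurable_det; apply: measurable_addmx; first exact: measurable_cst.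
  exact: measurable_sample_gram.
exact: (measurable_preimageT mG (measurable_set1 0)).
Qed.

(* The deterministic vectors s record the samples that Fubini has already fixed:
   a fixed sample outside the span of s raises its dimension by one. *)
Lemma sample_gram_null n (s : seq 'cV[R]_D) (a : pred 'I_n) :
  (D <= \dim (span s) + \sum_(i < n) a i)%N ->
  iid_law P n [set t | \det (gram s + sample_gram a t) = 0] = 0%E.
Proof.
elim: n s a => [|n IH] s a Ds.
  rewrite (_ : mkset _ = set0) ?measure0//; apply/seteqP; split => t //=.
  rewrite /sample_gram big_ord0 addr0 => /eqP; apply/negP/det_gram_span.
  by rewrite big_ord0 addn0 in Ds.
pose E : set (n.+1.-tuple T) := [set t | \det (gram s + sample_gram a t) = 0].
have mE : measurable E by exact: measurable_sample_gram_null.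
rewrite -/E iid_law_consE.
pose a' : pred 'I_n := fun i => a (lift ord0 i).
pose s' x := if a ord0 then phi x :: s else s.
have SE x t : gram s + sample_gram a (tuple_cons (x, t)) =
    gram (s' x) + sample_gram a' t.
  rewrite /sample_gram big_mkcond big_ord_recl -big_mkcond addrA /s'.
  congr (_ + _); last by apply: eq_bigr => i _; rewrite tnthS.
  case: ifPn => _; last by rewrite addr0.
  by rewrite /gram big_cons addrC.
have EE x : [set t | E (tuple_cons (x, t))] =
    [set t | \det (gram (s' x) + sample_gram a' t) = 0].
  by apply/seteqP; split => t; rewrite /E/= SE.
have := measurable_iid_law_section P mE.
have -> : (fun x => iid_law P n [set t | E (tuple_cons (x, t))]) =
    (fun x => iid_law P n [set t | \det (gram (s' x) + sample_gram a' t) = 0]).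
  by apply/funext => x; rewrite EE.
move: Ds; rewrite big_ord_recl -/(a' _) => Ds.
have [a0|na0] := boolP (a ord0); last first.
  move=> _; rewrite integral0_eq// => x _; rewrite /s' (negbTE na0) IH//.
  by rewrite (negbTE na0) in Ds.
rewrite a0 in Ds; rewrite /s' a0.
(* If [s] already spans, the induction hypothesis applies whatever the first sample is. *)
have [Dfull|nfull] := boolP (\det (gram s) != 0).
  move=> _; rewrite integral0_eq// => x _; apply: IH.
  rewrite (leq_trans _ (leq_addr _ _))//.
  have -> : span (phi x :: s) = fullv; last by rewrite dimvf /dim/= muln1.
  apply/eqP; rewrite eqEsubv subvf/=.
  suff -> : fullv = span s :> {vspace 'cV[R]_D} by rewrite span_cons addvSr.
  have : orth_compl (span s) = 0%VS.
    apply/eqP; rewrite -subv0; apply/subvP => u /memv_orth_compl us.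
    rewrite memv0; apply/eqP; have /det_gram_neq0 := Dfull; apply => v vs.
    by rewrite -[LHS]trmxK trmx_mul trmxK us ?trmx0// memv_span.
  have := dim_orth_compl (span s); move=> + s0; rewrite s0 dimv0 addn0 => sD.
  by apply/esym/eqP; rewrite eqEdim subvf dimvf /dim/= muln1 sD.
(* Otherwise the span of [s] lies in the hyperplane orthogonal to some [u != 0]. The new vector
   almost surely avoids this hyperplane, hence lies outside the span. *)
have [u us u0] : exists2 u : 'cV[R]_D, (forall v, v \in s -> u^T *m v = 0) & u != 0.
  apply: contrapT => h; move/negP: nfull; apply; apply/det_gram_neq0 => u us.
  apply: contrapT => /eqP u0.
  by apply: h; exists u.
move=> mI; rewrite (ae_eq_integral (cst 0%E)) ?integral0//.
exists [set x | u^T *m phi x = 0]; split => //.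
- apply: (@measurable_preimageT _ _ _ _ (fun x => u^T *m phi x) [set 0]).
    by apply: measurable_mulmx => //; exact: measurable_cst.
  rewrite (_ : [set 0] = (fun A : 'M[R]_1 => A 0 0) @^-1` [set 0]).
    by apply: measurable_preimageT; [exact: measurable_mx_entry|exact: measurable_set1].
  apply/seteqP; split => A /= => [->|A0]; first by rewrite mxE.
  by apply/matrixP => i j; rewrite !ord1 A0 mxE.
- exact: phi_hyperplane.
- move=> x /= nx; apply: contrapT => ux; apply: nx => _; apply: IH.
  rewrite span_cons dimv_disjoint_sum; last first.
    apply/eqP; rewrite -subv0; apply/subvP => w; rewrite memv_cap memv0.
    move=> /andP[/vlineP[k ->] ks]; rewrite scaler_eq0; apply/orP; left.
    apply: contra_notT ux => k0.
    have : u^T *m (k *: phi x) = 0.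
      move: (k *: phi x) ks => w' ws.
      rewrite (coord_span (X := in_tuple s) ws) mulmx_sumr big1// => i _.
      by rewrite -scalemxAr us ?scaler0// mem_nth.
    by rewrite -scalemxAr => /eqP; rewrite scaler_eq0 (negbTE k0) => /eqP.
  rewrite dim_vline (_ : (phi x != 0) = true) ?add1n//; last first.
    by apply: contra_notT ux; rewrite negbK => /eqP ->; rewrite mulmx0.
  by rewrite addSn -addnS; move: Ds; rewrite add1n.
Qed.

Definition large_subsets n : seq {set 'I_n} :=
  [seq I : {set 'I_n} <- enum {: {set 'I_n}} | (D <= #|I|)%N].

Definition degenerate_sample n : set (n.-tuple T) :=
  [set t | exists2 I, I \in large_subsets n & \det (sample_gram (mem I) t) = 0].

Lemma measurable_degenerate_sample n : measurable (@degenerate_sample n).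
Proof.
apply: measurable_exists_seq => I _.
have := measurable_sample_gram_null [::] (mem I).
by rewrite /gram big_nil; under eq_set do rewrite add0r.
Qed.

Lemma degenerate_sample_null n : iid_law P n (@degenerate_sample n) = 0%E.
Proof.
have mF (I : {set 'I_n}) : I \in large_subsets n ->
    measurable [set t | \det (gram [::] + sample_gram (mem I) t) = 0].
  by move=> _; exact: measurable_sample_gram_null.
apply/eqP; rewrite eq_le measure_ge0 andbT.
have -> : @degenerate_sample n = [set t | exists2 I, I \in large_subsets n &
    \det (gram [::] + sample_gram (mem I) t) = 0].
  rewrite /gram big_nil.
  by apply/seteqP; split => t [I IL It]; exists I => //; move: It; rewrite /= add0r.
apply: le_trans (measure_exists_seq_le (iid_law P n) mF) _.
rewrite big_seq big1// => I; rewrite mem_filter => /andP[DI _].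
apply: sample_gram_null.
by rewrite (leq_trans DI)// -sum1_card big_mkcond/= (leq_trans _ (leq_addl _ _))//.
Qed.

End general_position.

(** * Lower tail of the number of hits *)

Section sample_counts.
Context (R : realType) d (T : measurableType d) (P : probability T R).
Context (A : set T).
Hypothesis mA : measurable A.

Definition few_hits (n m : nat) : set (n.-tuple T) :=
  [set t | \sum_(i < n) \1_A (tnth t i) < m%:R :> R].
Arguments few_hits : clear implicits.

Lemma measurable_few_hits n m : measurable (few_hits n m).
Proof.
have mf : measurable_fun setT (fun t : n.-tuple T =>
    \sum_(i < n) \1_A (tnth t i) < m%:R :> R).
  apply: measurable_fun_ltr; last exact: measurable_cst.
  apply: measurable_sum => i; apply: measurableT_comp; first exact: measurable_indic.
  exact: measurable_tnth.
exact: (measurable_preimageT mf (A := [set true])).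
Qed.

(* Chernoff's bound for a binomial count, with exponential parameter ln 2. *)
Lemma iid_law_few_hits (p : R) n m : P A = p%:E ->
  (iid_law P n (few_hits n m) <= (2 ^+ m * (1 - p / 2) ^+ n)%:E)%E.
Proof.
move=> PA; have p01 : 0 <= p <= 1.
  by rewrite -!lee_fin -PA measure_ge0 probability_le1.
have few0 k : few_hits k 0 = set0.
  apply/seteqP; split => t //; rewrite /few_hits/= ltNge => /negP; apply.
  by apply: sumr_ge0 => i _; rewrite indicE.
elim: n m => [|n IH] [|m].
- by rewrite few0 measure0 lee_fin !expr0 mulr1 ler01.
- rewrite (le_trans (probability_le1 _ _))//; first exact: measurable_few_hits.
  by rewrite lee_fin expr0 mulr1 exprn_ege1// ler1n.
- by rewrite few0 measure0 lee_fin mulr_ge0// exprn_ge0//; lra.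
(* Conditioning on the first sample: a hit lowers the threshold by one. The induction closes because
   p / 2 + (1 - p) = 1 - p / 2. *)
have AE : (@tuple_cons d T n) @^-1` few_hits n.+1 m.+1 `<=`
    (A `*` few_hits n m) `|` (~` A `*` few_hits n m.+1).
  move=> [x t]; rewrite /few_hits/= big_ord_recl/= indicE.
  under eq_bigr do rewrite tnthS.
  have [xA|xA] := pselect (A x).
    by rewrite mem_set//= [m.+1%:R]mulrS ltrD2l => h; left.
  by rewrite memNset//= add0r => h; right.
have mC : measurable ((@tuple_cons d T n) @^-1` few_hits n.+1 m.+1).
  by apply: measurable_preimageT; [exact: measurable_tuple_cons|exact: measurable_few_hits].
have m1 : measurable (A `*` few_hits n m) by apply: measurableX => //; exact: measurable_few_hits.
have m2 : measurable (~` A `*` few_hits n m.+1).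
  by apply: measurableX; [exact: measurableC|exact: measurable_few_hits].
change (((P \x iid_law P n) ((@tuple_cons d T n) @^-1` few_hits n.+1 m.+1) <=
  (2 ^+ m.+1 * (1 - p / 2) ^+ n.+1)%:E)%E).
apply: (@le_trans _ _ ((P \x iid_law P n) ((A `*` few_hits n m) `|` (~` A `*` few_hits n m.+1)))%E).
  by apply: le_measure; rewrite ?inE//; exact: measurableU.
have E1 := product_measure1E P (iid_law P n) mA (@measurable_few_hits n m).
have E2 := product_measure1E P (iid_law P n) (measurableC mA) (@measurable_few_hits n m.+1).
apply: (@le_trans _ _ (P A * iid_law P n (few_hits n m) +
    P (~` A) * iid_law P n (few_hits n m.+1))%E).
  by rewrite -E1 -E2; exact: measureU2.
rewrite probability_setC// PA.
have q0 : 0 <= 1 - p by lra.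
have p0 : 0 <= p by lra.
apply: (@le_trans _ _ (p%:E * (2 ^+ m * (1 - p / 2) ^+ n)%:E +
    (1 - p)%:E * (2 ^+ m.+1 * (1 - p / 2) ^+ n)%:E)%E).
  by apply: leeD; apply: lee_wpmul2l => //; rewrite lee_fin.
rewrite -!EFinM -EFinD lee_fin !exprS le_eqVlt; apply/orP; left; apply/eqP.
by field.
Qed.

End sample_counts.
Arguments few_hits R {d T} A n m.

(** * The estimator *)

Section projections_and_norms.
Context (R : realType).

Lemma mulmx_col_span m n (U : 'M[R]_(m, n)) (c : 'cV[R]_n) : U *m c \in col_span U.
Proof.
have -> : U *m c = \sum_j c j 0 *: col j U.
  apply/matrixP => i k; rewrite !ord1 mxE summxE.
  by apply: eq_bigr => j _; rewrite !mxE mulrC.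
by apply: rpred_sum => j _; apply/rpredZ/memv_span/map_f; rewrite mem_enum.
Qed.

Lemma col_spanP m n (U : 'M[R]_(m, n)) (u : 'cV[R]_m) :
  u \in col_span U -> exists c, u = U *m c.
Proof.
move=> uS; rewrite (coord_span (X := in_tuple [seq col j U | j : 'I_n]) uS).
apply: (@big_ind _ (fun w => exists c, w = U *m c)).
- by exists 0; rewrite mulmx0.
- by move=> _ _ [a ->] [b ->]; exists (a + b); rewrite mulmxDr.
move=> i _; have : [seq col j U | j : 'I_n]`_i \in [seq col j U | j : 'I_n].
  exact: mem_nth.
move=> /mapP[j _ ->]; exists (coord (in_tuple [seq col j U | j : 'I_n]) i u *: delta_mx j 0).
by rewrite -scalemxAr -colE.
Qed.

Lemma dim_col_span m n (U : 'M[R]_(m, n)) : U^T *m U \in unitmx ->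
  \dim (col_span U) = n.
Proof.
move=> UU; pose X := [tuple col j U | j < n].
have -> : col_span U = span X by [].
suff /eqP -> : free X by rewrite size_tuple.
apply/freeP => k kX i.
have Uk : U *m (\col_j k j) = 0.
  rewrite -kX; apply/matrixP => a b; rewrite !ord1 mxE summxE.
  apply: eq_bigr => j _; rewrite [RHS]mxE -tnth_nth tnth_mktuple !mxE.
  exact: mulrC.
have : \col_j k j = 0 by rewrite -[LHS](mulKmx UU) -mulmxA Uk !mulmx0.
by move=> /matrixP/(_ i 0); rewrite !mxE.
Qed.

(** The residual is orthogonal to the columns of [U]. This closed formula is what makes the
    projection measurable in [U]. *)
Lemma orth_proj_col_span m n (U : 'M[R]_(m, n)) (v : 'cV[R]_m) :
  U^T *m U \in unitmx ->
  orth_proj (col_span U) v = U *m (invmx (U^T *m U) *m (U^T *m v)).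
Proof.
move=> UU; apply: orth_proj_unique; first exact: mulmx_col_span.
move=> _ /col_spanP[c ->]; rewrite trmx_mul -mulmxA mulmxBr.
by rewrite (mulmxA U^T) mulKVmx// subrr mulmx0.
Qed.

Lemma euclid_norm_ge0 n (v : 'cV[R]_n) : 0 <= euclid_norm v.
Proof. exact: sqrtr_ge0. Qed.

Lemma euclid_norm_sqr n (v : 'cV[R]_n) : euclid_norm v ^+ 2 = \sum_i v i 0 ^+ 2.
Proof. by rewrite sqr_sqrtr// sumr_ge0// => i _; exact: sqr_ge0. Qed.

Lemma euclid_normZ n (k : R) (v : 'cV[R]_n) :
  euclid_norm (k *: v) = `|k| * euclid_norm v.
Proof.
rewrite /euclid_norm -sqrtr_sqr -sqrtrM ?sqr_ge0// mulr_sumr.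
by congr Num.sqrt; apply: eq_bigr => i _; rewrite mxE exprMn.
Qed.

Lemma euclid_norm_eq0 n (v : 'cV[R]_n) : (euclid_norm v == 0) = (v == 0).
Proof.
apply/idP/eqP => [|->]; last first.
  by rewrite /euclid_norm big1 ?sqrtr0// => i _; rewrite mxE expr0n.
rewrite -sqrf_eq0 euclid_norm_sqr psumr_eq0 => [/allP h|i _]; last exact: sqr_ge0.
apply/matrixP => i j; rewrite (ord1 j) mxE; apply/eqP.
by have := h i (mem_index_enum i); rewrite sqrf_eq0.
Qed.

Lemma linear_cV_sum m n (f : 'Hom('cV[R]_m, 'cV[R]_n)) v i :
  f v i 0 = \sum_j v j 0 * f (delta_mx j 0) i 0.
Proof.
have {1}-> : v = \sum_j v j 0 *: delta_mx j 0.
  rewrite [LHS]matrix_sum_delta; apply: eq_bigr => j _.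
  by rewrite big_ord1.
by rewrite linear_sum summxE; apply: eq_bigr => j _; rewrite linearZ mxE.
Qed.

Lemma op_norm_leP m n (f : 'Hom('cV[R]_m, 'cV[R]_n)) (e : R) : 0 <= e ->
  op_norm f <= e <-> forall v, euclid_norm (f v) <= e * euclid_norm v.
Proof.
move=> e0; rewrite /op_norm; set A := (X in sup X).
have A0 : A !=set0 by exists (euclid_norm (f 0)), 0 => //=;
  have /eqP -> : euclid_norm (0 : 'cV[R]_m) == 0 by rewrite euclid_norm_eq0.
split=> [fe v|fe]; last first.
  apply: ge_sup => // _ [v /= v1 <-]; rewrite (le_trans (fe v))//.
  by rewrite ler_piMr.
(* The coordinates of a vector of norm at most 1 are at most 1 in absolute value, which bounds each
   coordinate of its image by a row sum. *)
have Aub : has_ubound A.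
  exists (Num.sqrt (\sum_i (\sum_j `|f (delta_mx j 0) i 0|) ^+ 2)) => _ [w /= w1 <-].
  rewrite ler_sqrt ?sumr_ge0//; last by move=> i _; exact: sqr_ge0.
  apply: ler_sum => i _; rewrite -[leLHS]real_normK ?num_real//.
  rewrite lerXn2r ?nnegrE ?sumr_ge0// linear_cV_sum (le_trans (ler_norm_sum _ _ _))//.
  apply: ler_sum => j _; rewrite normrM ler_piMl// (le_trans _ w1)//.
  rewrite -sqrtr_sqr ler_sqrt ?sumr_ge0//; last by move=> k _; exact: sqr_ge0.
  by rewrite (bigD1 j)//= lerDl sumr_ge0// => k _; exact: sqr_ge0.
have [->|v0] := eqVneq v 0.
  by rewrite linear0 (eqP (_ : euclid_norm 0 == 0)) ?euclid_norm_eq0// mulr_ge0 ?euclid_norm_ge0.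
have nv0 : 0 < euclid_norm v by rewrite lt_def euclid_norm_ge0 euclid_norm_eq0 v0.
have {1}-> : v = euclid_norm v *: ((euclid_norm v)^-1 *: v).
  by rewrite scalerA divff ?gt_eqF// scale1r.
rewrite linearZ euclid_normZ ger0_norm ?euclid_norm_ge0// mulrC ler_pM2r//.
apply: le_trans fe; apply: ub_le_sup => //; eexists; last reflexivity.
by rewrite /= euclid_normZ normfV ger0_norm ?euclid_norm_ge0// mulVf ?gt_eqF.
Qed.

(* By density it suffices to test the operator norm on rational vectors. *)
Lemma op_norm_le_rat m n (f : 'Hom('cV[R]_m, 'cV[R]_n)) (e : R) : 0 <= e ->
  op_norm f <= e <-> forall q : 'cV[rat]_m,
    \sum_i f (map_mx ratr q) i 0 ^+ 2 <= e ^+ 2 * \sum_i ratr (q i 0) ^+ 2.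
Proof.
move=> e0; have sq v : (euclid_norm (f v) <= e * euclid_norm v) =
    (\sum_i f v i 0 ^+ 2 <= e ^+ 2 * \sum_i v i 0 ^+ 2).
  rewrite -!euclid_norm_sqr -exprMn ler_pXn2r// nnegrE ?euclid_norm_ge0//.
  by rewrite mulr_ge0 ?euclid_norm_ge0.
rewrite op_norm_leP//; split=> [fe q|fe v].
  by have := fe (map_mx ratr q); rewrite sq; under [X in _ <= _ * X]eq_bigr do rewrite mxE.
rewrite sq.
have qv (k : nat) : exists q : 'cV[rat]_m, forall i,
    v i 0 < ratr (q i 0) < v i 0 + k.+1%:R^-1.
  have h i : exists x : rat, v i 0 < ratr x < v i 0 + k.+1%:R^-1.
    have [|x] := @rat_in_itvoo R (v i 0) (v i 0 + k.+1%:R^-1).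
      by rewrite ltrDl invr_gt0 ltr0n.
    by rewrite in_itv => ?; exists x.
  exists (\col_i sval (cid (h i))) => i; rewrite mxE.
  exact: svalP (cid (h i)).
pose q k := sval (cid (qv k)).
have qcvg i : ratr (q k i 0) @[k --> \oo] --> v i 0.
  apply: (@squeeze_cvgr _ _ _ _ (cst (v i 0)) (fun k => v i 0 + harmonic k)).
  - apply: nearW => k; have := svalP (cid (qv k)) i.
    by rewrite -/(q k) => /andP[/ltW -> /ltW ->].
  - exact: cvg_cst.
  - by rewrite -[X in _ --> X]addr0; apply: cvgD; [exact: cvg_cst|exact: cvg_harmonic].
have cvgS (I : finType) (F : I -> nat -> R) (l : I -> R) :
    (forall i, F i k @[k --> \oo] --> l i) ->
    (\sum_i F i k) @[k --> \oo] --> \sum_i l i.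
  by move=> Fl; apply: cvg_big => //; exact: add_continuous.
have cvgX (F : nat -> R) (l : R) : F k @[k --> \oo] --> l -> (F k ^+ 2) @[k --> \oo] --> l ^+ 2.
  by move=> Fl; rewrite expr2; under eq_fun do rewrite expr2; exact: cvgM.
apply: (@ler_cvg_to nat \oo _ R (fun k => \sum_i f (map_mx ratr (q k)) i 0 ^+ 2)
  (fun k => e ^+ 2 * \sum_i ratr (q k i 0) ^+ 2)).
- apply: (cvgS _ (fun i k => f (map_mx ratr (q k)) i 0 ^+ 2)) => i.
  apply: cvgX; rewrite linear_cV_sum; under eq_fun do rewrite linear_cV_sum.
  apply: (cvgS _ (fun j k => map_mx ratr (q k) j 0 * f (delta_mx j 0) i 0)) => j.
  apply: cvgM; last exact: cvg_cst.
  by under eq_fun do rewrite mxE; exact: qcvg.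
- apply: cvgM; first exact: cvg_cst.
  apply: (cvgS _ (fun i k => ratr (q k i 0) ^+ 2)) => i.
  by apply: cvgX; exact: qcvg.
- exact: nearW.
Qed.

Lemma measurable_op_norm_le d (T : measurableType d) m n
    (f : T -> 'Hom('cV[R]_m, 'cV[R]_n)) (e : R) : 0 <= e ->
  (forall v, measurable_fun setT (fun t => f t v)) ->
  measurable [set t | op_norm (f t) <= e].
Proof.
move=> e0 mf; pose F k : set T := if unpickle k is Some q then
  [set t | \sum_i f t (map_mx ratr (q : 'cV[rat]_m)) i 0 ^+ 2 <=
           e ^+ 2 * \sum_i ratr (q i 0) ^+ 2] else setT.
rewrite (_ : mkset _ = \bigcap_k F k); last first.
  apply/seteqP; split => t /=.
    by move=> /op_norm_le_rat h k _; rewrite /F; case: unpickle => // q; exact: h.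
  by move=> h; apply/op_norm_le_rat => // q; have := h (pickle q) I; rewrite /F pickleK.
apply: bigcapT_measurable => k; rewrite /F; case: unpickle => // q.
pose c : R := e ^+ 2 * \sum_i ratr (q i 0) ^+ 2.
have mg : measurable_fun setT (fun t =>
    \sum_i f t (map_mx ratr (q : 'cV[rat]_m)) i 0 ^+ 2 <= c).
  apply: measurable_fun_ler; last exact: measurable_cst.
  apply: measurable_sum => i; apply: measurable_funX.
  by have /measurable_mxP := mf (map_mx ratr q); exact.
exact: (measurable_preimageT mg (A := [set true])).
Qed.

End projections_and_norms.

(** * Least-squares fits and the estimator *)

Section estimator.
Context (R : realType) (d r n m : nat).

(** Affine functions of [x] become linear forms in [homog x], and affine independence becomes linear
    independence. *)
Definition homog (x : 'cV[R]_d) : 'cV[R]_(d + 1) := col_mx x 1%:M.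

Lemma measurable_homog : measurable_fun setT homog.
Proof. by apply: measurable_col_mx; [exact: measurable_id|exact: measurable_cst]. Qed.

Lemma gaussian_homog_hyperplane0 (u : 'cV[R]_(d + 1)) : u != 0 ->
  gaussian R d [set x | u^T *m homog x = 0] = 0%E.
Proof.
move=> u0; have uE x : (u^T *m homog x) 0 0 =
    ((usubmx u)^T *m x) 0 0 + dsubmx u 0 0.
  rewrite -{1}[u]vsubmxK tr_col_mx mul_row_col mulmx1 mxE; congr (_ + _).
  exact: mxE.
rewrite (_ : mkset _ = [set x | ((usubmx u)^T *m x) 0 0 + dsubmx u 0 0 = 0]).
  apply: gaussian_hyperplane0; apply: contra_neqT u0; rewrite negb_or !negbK.
  move=> /andP[/eqP a0 /eqP b0]; rewrite -[u]vsubmxK a0.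
  by rewrite [dsubmx u]mx11_scalar b0 raddf0 col_mx0.
apply/seteqP; split => x /=; rewrite -uE; first by move=> ->; rewrite mxE.
by move=> ux; apply/matrixP => i j; rewrite !ord1 ux mxE.
Qed.

Local Notation data := (n.-tuple ('cV[R]_d * R)).

Definition normal_matrix (I : {set 'I_n}) (S : data) : 'M[R]_(d + 1) :=
  sample_gram (homog \o fst) (mem I) S.

(** When the normal matrix is invertible and some affine function fits the samples of [I] exactly,
    this formula returns it; the first [d] coordinates are the slope, the last one the intercept. *)
Definition least_squares (I : {set 'I_n}) (S : data) : 'cV[R]_(d + 1) :=
  invmx (normal_matrix I S) *m
    \sum_(i in I) (tnth S i).2 *: homog (tnth S i).1.

Definition exact_fit (I : {set 'I_n}) (S : data) : bool :=
  (m <= #|I|)%N && [forall i in I,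
    ((least_squares I S)^T *m homog (tnth S i).1) 0 0 == (tnth S i).2].

Definition slopes (c : {ffun 'I_r -> {set 'I_n}}) (S : data) : 'M[R]_(d, r) :=
  \matrix_(a, j) usubmx (least_squares (c j) S) a 0.

Definition admissible (c : {ffun 'I_r -> {set 'I_n}}) (S : data) : bool :=
  [forall j, exact_fit (c j) S] && (\det ((slopes c S)^T *m slopes c S) != 0).

(* The first admissible family; pid_mx r is a default frame that keeps the
   dimension equal to r on every data set. *)
Definition frame_estimate (S : data) : 'M[R]_(d, r) :=
  foldr (fun c U => if admissible c S then slopes c S else U) (pid_mx r)
    (enum {: {ffun 'I_r -> {set 'I_n}}}).

Lemma measurable_least_squares I : measurable_fun setT (least_squares I).
Proof.
have mh i : measurable_fun setT (fun S : data => homog (tnth S i).1).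
  apply: measurableT_comp; first exact: measurable_homog.
  by apply: measurableT_comp => //; exact: measurable_tnth.
apply: measurable_mulmx.
  apply: measurable_invmx; apply: measurable_sample_gram.
  by apply: measurableT_comp => //; exact: measurable_homog.
apply: measurable_summx => i _; apply: measurable_scalemx => //.
by apply: measurableT_comp => //; exact: measurable_tnth.
Qed.

Lemma measurable_forall_fin d1 (T : measurableType d1) (J : finType)
    (f : J -> T -> bool) : (forall j, measurable_fun setT (f j)) ->
  measurable_fun setT (fun t => [forall j, f j t]).
Proof.
move=> mf; have E t : [forall j, f j t] = \big[andb/true]_j f j t by rewrite big_andE.
under eq_fun do rewrite E.
elim: (index_enum J) => [|j s IH].
  by under eq_fun do rewrite big_nil; exact: measurable_cst.
by under eq_fun do rewrite big_cons; exact: measurable_and.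
Qed.

Lemma measurable_exact_fit I : measurable_fun setT (exact_fit I).
Proof.
apply: measurable_and; first exact: measurable_cst.
apply: measurable_forall_fin => i; case: (i \in I) => /=; last exact: measurable_cst.
apply: measurable_fun_eqr; last first.
  by apply: measurableT_comp => //; exact: measurable_tnth.
suff /measurable_mxP : measurable_fun setT (fun S : data =>
    (least_squares I S)^T *m homog (tnth S i).1) by exact.
apply: measurable_mulmx; first by apply: measurable_trmx; exact: measurable_least_squares.
apply: measurableT_comp; first exact: measurable_homog.
by apply: measurableT_comp => //; exact: measurable_tnth.
Qed.

Lemma measurable_slopes c : measurable_fun setT (slopes c).
Proof.
apply/measurable_mxP => a j; under eq_fun do rewrite mxE.
have := measurable_usubmx (measurable_least_squares (c j)).
by move/measurable_mxP; exact.
Qed.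

Lemma measurable_frame_estimate : measurable_fun setT frame_estimate.
Proof.
rewrite /frame_estimate; elim: (enum _) => [|c s IH] /=; first exact: measurable_cst.
apply: measurable_fun_ifT => //; last exact: measurable_slopes.
apply: measurable_and.
  by apply: measurable_forall_fin => j; exact: measurable_exact_fit.
apply: measurable_neg; apply: measurable_fun_eqr => //.
apply: measurable_det; apply: measurable_mulmx; last exact: measurable_slopes.
by apply: measurable_trmx; exact: measurable_slopes.
Qed.

Lemma frame_estimate_admissible S c0 : admissible c0 S ->
  exists2 c, admissible c S & frame_estimate S = slopes c S.
Proof.
rewrite /frame_estimate; have : c0 \in enum {: {ffun 'I_r -> {set 'I_n}}}.
  by rewrite mem_enum.
elim: (enum _) => //= c s IH; rewrite inE => /predU1P[<- ac|c0s ac0].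
  by rewrite ac; exists c0.
by case: ifPn => [ac|_]; [exists c|exact: IH].
Qed.

Hypothesis rd : (r <= d)%N.

Lemma frame_estimate_unitmx S :
  (frame_estimate S)^T *m frame_estimate S \in unitmx.
Proof.
rewrite /frame_estimate; elim: (enum _) => [|c s IH] /=.
  by rewrite tr_pid_mx pid_mx_id// pid_mx_1 unitmx1.
by case: ifPn => // /andP[_]; rewrite unitmxE unitfE.
Qed.

Definition span_estimate (S : data) : {vspace 'cV[R]_d} := col_span (frame_estimate S).

Lemma measurable_span_estimate v :
  measurable_fun setT (fun S => orth_proj (span_estimate S) v).
Proof.
under eq_fun do rewrite orth_proj_col_span ?frame_estimate_unitmx//.
have mU := measurable_frame_estimate; have mUT := measurable_trmx mU.
apply: measurable_mulmx => //; apply: measurable_mulmx.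
  by apply: measurable_invmx; exact: measurable_mulmx.
by apply: measurable_mulmx => //; exact: measurable_cst.
Qed.

Lemma span_estimate_estimator : subspace_estimator r span_estimate.
Proof.
split=> [S|v]; first exact/dim_col_span/frame_estimate_unitmx.
exact: measurable_span_estimate.
Qed.

End estimator.

(** * Exact recovery on a good sample *)

Section recovery.
Context (R : realType) (d r n : nat) (sigma : 'cV[R]_r -> R).
Context (s : seq ('cV[R]_r * R)).
Hypothesis cover : forall z, exists2 p, p \in s & affine_piece sigma p z.
Hypothesis spans : span [seq p.1 | p <- s] = fullv.
Context (W : 'M[R]_(d, r)) (x : n.-tuple 'cV[R]_d).
Hypothesis WW : W^T *m W = 1%:M.

Local Notation m := (size s * (d + 1))%N.
Local Notation S := (labelled_sample (fun z => sigma (W^T *m z)) x).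

Definition piece_sample (p : 'cV[R]_r * R) : {set 'I_n} :=
  finset (fun i => `[< affine_piece sigma p (W^T *m tnth x i) >]).

Hypothesis generic : forall I : {set 'I_n}, (d + 1 <= #|I|)%N ->
  \det (sample_gram (@homog R d) (mem I) x) != 0.
Hypothesis enough : forall p, p \in s -> (m <= #|piece_sample p|)%N.

Let lift_piece (p : 'cV[R]_r * R) : 'cV[R]_(d + 1) := col_mx (W *m p.1) p.2%:M.

Let tnth_S i : tnth S i = (tnth x i, sigma (W^T *m tnth x i)).
Proof. by rewrite tnth_map. Qed.

Let normal_matrixE I : normal_matrix I S = sample_gram (@homog R d) (mem I) x.
Proof.
by rewrite /normal_matrix /sample_gram; apply: eq_bigr => i _; rewrite /= tnth_S.
Qed.

Let lift_pieceE p i : i \in piece_sample p ->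
  ((lift_piece p)^T *m homog (tnth x i)) 0 0 = sigma (W^T *m tnth x i).
Proof.
rewrite inE => /asboolP ->; rewrite /lift_piece tr_col_mx mul_row_col.
rewrite trmx_mul -mulmxA mxE; congr (_ + _).
by rewrite mulmx1 tr_scalar_mx mxE eqxx mulr1n.
Qed.

(** The difference [u - v] is orthogonal to all [homog (tnth x i)] with [i] in [I], so their second
    moment matrix, invertible by [generic], kills it. *)
Let eq_on_sample (I : {set 'I_n}) (u v : 'cV[R]_(d + 1)) : (d + 1 <= #|I|)%N ->
  (forall i, i \in I -> (u^T *m homog (tnth x i)) 0 0 = (v^T *m homog (tnth x i)) 0 0) ->
  u = v.
Proof.
move=> DI uv; have gU : sample_gram (@homog R d) (mem I) x \in unitmx.
  by rewrite unitmxE unitfE generic.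
apply/eqP; rewrite -subr_eq0 -[u - v](mulKmx gU) [X in invmx _ *m X](_ : _ = 0) ?mulmx0//.
rewrite /sample_gram mulmx_suml big1// => i iI; rewrite -mulmxA.
suff -> : (homog (tnth x i))^T *m (u - v) = 0 by rewrite mulmx0.
apply: trmx_inj; rewrite trmx_mul trmxK trmx0 linearB mulmxBl.
by apply/matrixP => a b; rewrite !ord1 [LHS]mxE [X in _ + X]mxE uv// subrr mxE.
Qed.

Let s_gt0 : (0 < size s)%N.
Proof. by have [p] := cover 0; case: s. Qed.

(* Pigeonhole: some piece contains d + 1 samples of any exactly fitted set, and
   these determine the affine function. *)
Let exact_fit_piece (I : {set 'I_n}) : exact_fit m I S ->
  exists2 p, p \in s & least_squares I S = lift_piece p.
Proof.
move=> /andP[mI /forall_inP fitI].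
have [p ps Dp] : exists2 p, p \in s & (d + 1 <= #|I :&: piece_sample p|)%N.
  apply/hasP; rewrite -[has _ _]negbK -all_predC; apply/negP => /allP h.
  have : (#|I| <= \sum_(p <- s) #|I :&: piece_sample p|)%N.
    rewrite -sum1_card; under [leqRHS]eq_bigr => p _ do rewrite -sum1_card.
    have -> : (\sum_(p <- s) \sum_(i in I :&: piece_sample p) 1 =
        \sum_(i in I) \sum_(p <- s | i \in piece_sample p) 1)%N.
      rewrite (exchange_big_dep (mem I))/= => [|p i _]; last by rewrite inE => /andP[].
      apply: eq_bigr => i iI; apply: eq_bigl => p; by rewrite inE iI.
    apply: leq_sum => i _; have [p ps pi] := cover (W^T *m tnth x i).
    have ip : i \in piece_sample p by rewrite inE; apply/asboolP.
    by rewrite (big_rem p)//= ip leq_addr.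
  apply/negP; rewrite -ltnNge; apply: leq_trans mI.
  (* Each piece would hold at most [d] samples of [I], hence [size s * d] in all, strictly below the
     threshold [m] as [s] is nonempty. *)
  rewrite (@leq_ltn_trans (\sum_(p <- s) d)%N)//.
    rewrite big_seq [leqRHS]big_seq; apply: leq_sum => p ps.
    by have := h p ps; rewrite /= -ltnNge addn1.
  by rewrite big_const_seq count_predT iter_addn_0 mulnC ltn_pmul2l// addn1.
exists p => //; apply: eq_on_sample Dp _ => i; rewrite inE => /andP[iI ip].
by rewrite lift_pieceE//; have /eqP := fitI i iI; rewrite tnth_S.
Qed.

(** The labels on [piece_sample p] are the values of [lift_piece p], so the right side of the normal
    equations is the normal matrix applied to [lift_piece p]. *)
Let piece_exact_fit p : p \in s -> exact_fit m (piece_sample p) S /\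
  least_squares (piece_sample p) S = lift_piece p.
Proof.
move=> ps; have DI : (d + 1 <= #|piece_sample p|)%N.
  by rewrite (leq_trans _ (enough ps))// leq_pmull.
have fitE : least_squares (piece_sample p) S = lift_piece p.
  have gU : normal_matrix (piece_sample p) S \in unitmx.
    by rewrite normal_matrixE unitmxE unitfE generic.
  rewrite -[RHS](mulKmx gU) /least_squares; congr (_ *m _).
  rewrite normal_matrixE /sample_gram mulmx_suml; apply: eq_bigr => i ip.
  rewrite tnth_S/= -(lift_pieceE ip) -mulmxA -mul_mx_scalar; congr (_ *m _).
  by rewrite -[RHS]trmxK trmx_mul trmxK [in RHS](mx11_scalar (_ *m _)) tr_scalar_mx.
split=> //; apply/andP; split; first exact: enough.
by apply/forall_inP => i ip; rewrite fitE tnth_S/= lift_pieceE.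
Qed.

Let slopes_lift (c : {ffun 'I_r -> {set 'I_n}}) (q : 'I_r -> 'cV[R]_r * R) :
  (forall j, least_squares (c j) S = lift_piece (q j)) ->
  slopes c S = W *m \matrix_(a, j) (q j).1 a 0.
Proof.
move=> cq; apply/matrixP => a j; rewrite mxE cq /lift_piece col_mxKu !mxE.
by apply: eq_bigr => b _; rewrite mxE.
Qed.

(** Independence of the slopes [W *m A] can thus be tested on [A], without [W]. *)
Let gramW (A : 'M[R]_r) : (W *m A)^T *m (W *m A) = A^T *m A.
Proof. by rewrite trmx_mul -mulmxA (mulmxA W^T) WW mul1mx. Qed.

(** The matrix [M] with the slopes as rows has full column rank, as a vector orthogonal to all
    slopes is 0; [fullrankfun] selects [r] of its rows that form an invertible matrix. *)
Lemma spanning_subfamily : exists q : 'I_r -> 'cV[R]_r * R,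
  (forall j, q j \in s) /\ \matrix_(a, j) (q j).1 a 0 \in unitmx.
Proof.
pose p0 : 'cV[R]_r * R := (0, 0).
pose M : 'M[R]_(size s, r) := \matrix_(k, a) (nth p0 s k).1 a 0.
have Mfull : row_full M.
  rewrite /row_full -mxrank_tr; apply/row_freeP.
  apply/row_freeP; rewrite -kermx_eq0; apply/rowV0P => u /sub_kermxP uM.
  have : u^T \in orth_compl fullv.
    apply/memv_orth_compl => w; rewrite -spans => ws.
    rewrite (coord_span (X := in_tuple [seq p.1 | p <- s]) ws) linear_sum mulmx_suml.
    rewrite big1// => k _.
    rewrite linearZ/= -scalemxAl.
    have ks : (k < size s)%N by apply: leq_trans (ltn_ord k) _; rewrite size_map.
    have -> : ([seq p.1 | p <- s]`_k)^T *m u^T = 0; last by rewrite scaler0.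
    rewrite (nth_map p0)//; apply: trmx_inj; rewrite trmx_mul !trmxK trmx0.
    apply/matrixP => a b; move/matrixP/(_ a (Ordinal ks)): uM.
    rewrite !ord1 !mxE => h; apply: etrans h; apply: eq_bigr => l _.
    by rewrite !mxE.
  move=> uO; have : u^T \in (fullv :&: orth_compl fullv)%VS by rewrite memv_cap memvf.
  by rewrite capv_orth_compl memv0 trmx_eq0 => /eqP.
exists (fun j => nth p0 s (fullrankfun Mfull j)); split=> [j|].
  exact: mem_nth.
rewrite (_ : \matrix_(a, j) _ = (rowsub (fullrankfun Mfull) M)^T).
  by rewrite unitmx_tr fullrowsub_unit.
by apply/matrixP => a j; rewrite !mxE.
Qed.

(** The family [c0] of true pieces shows that an admissible family exists, but the estimator may
    select another one, [c]. Its slopes still have the form [W *m B], and independence makes the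
    dimensions agree. *)
Theorem span_estimate_recovers : span_estimate r m S = col_span W.
Proof.
have [q [qs qU]] := spanning_subfamily.
pose c0 : {ffun 'I_r -> {set 'I_n}} := [ffun j => piece_sample (q j)].
have c0S : admissible m c0 S.
  apply/andP; split.
    by apply/forallP => j; rewrite ffunE; have [] := piece_exact_fit (qs j).
  rewrite (@slopes_lift c0 q) => [|j]; last first.
    by rewrite ffunE; have [] := piece_exact_fit (qs j).
  by rewrite gramW -unitfE -unitmxE unitmx_mul unitmx_tr qU.
have [c /andP[/forallP cfit cdet] cE] := frame_estimate_admissible c0S.
have p_ j : {p | least_squares (c j) S = lift_piece p}.
  by apply: cid; have [p _ ?] := exact_fit_piece (cfit j); exists p.
move: cdet; rewrite /span_estimate cE (@slopes_lift c (fun j => sval (p_ j))); last first.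
  by move=> j; exact: svalP (p_ j).
set B := \matrix_(a, j) _ => cdet.
apply/eqP; rewrite eqEdim; apply/andP; split.
  by apply/subvP => _ /col_spanP[e ->]; rewrite -mulmxA mulmx_col_span.
by rewrite !dim_col_span ?WW ?unitmx1// unitmxE unitfE.
Qed.

End recovery.

(** * Failure probability and constants *)

Section success_probability.
Context (R : realType).

Lemma relu_active_spanning_pieces r (sigma : 'cV[R]_r -> R) :
  scalar_relu_network sigma -> full_intrinsic_dimension sigma ->
  exists (s : seq ('cV[R]_r * R)) (q : R), [/\ 0 < q,
    (forall z, exists2 p, p \in s & affine_piece sigma p z),
    span [seq p.1 | p <- s] = fullv &
    forall p, p \in s -> exists2 qp, q <= qp &
      gaussian R r (affine_piece sigma p) = qp%:E].
Proof.
move=> net full; have [s [cover act]] := active_pieces_cover net.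
have [q q0 hq] : exists2 q : R, 0 < q & forall p, p \in s -> exists2 qp, q <= qp &
    gaussian R r (affine_piece sigma p) = qp%:E.
  elim: s act {cover} => [|p s IH] act; first by exists 1.
  have [|q q0 hq] := IH; first by move=> t ts; apply: act; rewrite inE ts orbT.
  have := act p (mem_head _ _).
  have pfin : gaussian R r (affine_piece sigma p) \is a fin_num.
    by apply: fin_num_measure; exact: (measurable_affine_piece p (measurable_scalar_relu net)).
  rewrite -(fineK pfin) lte_fin; set qp := fine _ => qp0.
  exists (Num.min q qp); first by rewrite lt_min q0.
  move=> t; rewrite inE => /predU1P[->|ts].
    by exists qp; [rewrite ge_min lexx orbT|rewrite /qp (fineK pfin)].
  by have [qt qqt gt] := hq t ts; exists qt; rewrite // ge_min qqt.
by exists s, q; split => //; exact: pieces_span cover.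
Qed.

(** With 2 <= e, K <= exp(K) and 1 - q/2 <= exp(- q/2), the exponent is at most K + K (d + 1) - n
    q/2. Since d >= 1, the positive terms are at most 3 K d, and the hypothesis on [n] says n q/2 >=
    (3 K + 1) d; what remains is - d. *)
Lemma few_hits_exp (K d n : nat) (q : R) : (0 < d)%N -> 0 < q <= 1 ->
  2 * (3 * K%:R + 1) / q * d%:R <= n%:R ->
  K%:R * (2 ^+ (K * (d + 1)) * (1 - q / 2) ^+ n) <= expR (- d%:R).
Proof.
move=> d0 /andP[q0 q1] nC.
have e2 : (2 : R) <= expR 1 by rewrite -[2]/(1 + 1) expR_ge1Dx.
have h1 : (2 : R) ^+ (K * (d + 1)) <= expR ((K * (d + 1))%:R).
  by rewrite -[in leRHS](mulr1 (K * (d + 1))%:R) expRM_natl lerXn2r ?nnegrE ?expR_ge0.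
have h2 : (1 - q / 2) ^+ n <= expR (- (n%:R * (q / 2))).
  rewrite -[- (n%:R * _)]mulrN expRM_natl lerXn2r ?nnegrE ?expR_ge0//; first by lra.
  exact: expR_ge1Dx.
have h3 : K%:R <= expR (K%:R) :> R.
  by apply: le_trans (expR_ge1Dx _); rewrite lerDr.
apply: (@le_trans _ _ (expR K%:R * (expR ((K * (d + 1))%:R) *
    expR (- (n%:R * (q / 2)))))).
  apply: ler_pM => //; first by rewrite mulr_ge0// ?exprn_ge0//; lra.
  by apply: ler_pM => //; rewrite exprn_ge0//; lra.
rewrite -!expRD ler_expR natrM natrD.
have d1 : 1 <= d%:R :> R by rewrite ler1n.
have k0 : 0 <= K%:R :> R by rewrite ler0n.
have nq : (3 * K%:R + 1) * d%:R <= n%:R * (q / 2).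
  move: nC; rewrite mulrAC ler_pdivrMr// => nC; lra.
have : K%:R <= K%:R * d%:R :> R by rewrite ler_peMr.
lra.
Qed.

(** Failure forces some piece to be hit fewer than [m] times, the event [F], or the sample to be
    degenerate, the null event [G]. A union bound over the pieces controls [F]; elsewhere recovery
    is exact and the distance is 0. *)
Lemma span_estimate_success r (sigma : 'cV[R]_r -> R) (s : seq ('cV[R]_r * R))
    (q eps : R) (d n : nat) (W : 'M[R]_(d, r)) :
  measurable_fun setT sigma -> 0 < q <= 1 -> 0 <= eps ->
  (forall z, exists2 p, p \in s & affine_piece sigma p z) ->
  span [seq p.1 | p <- s] = fullv ->
  (forall p, p \in s -> exists2 qp, q <= qp &
    gaussian R r (affine_piece sigma p) = qp%:E) ->
  (r <= d)%N -> W^T *m W = 1%:M ->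
  ((1 - (size s)%:R * (2 ^+ (size s * (d + 1)) * (1 - q / 2) ^+ n))%:E <=
   iid_law (gaussian R d) n
     [set x | (subspace_dist
        (span_estimate r (size s * (d + 1)) (labelled_sample (fun z => sigma (W^T *m z)) x))
        (col_span W) <= eps)%R])%E.
Proof.
move=> msigma q01 eps0 cover spans hq rd WW; set m := (size s * (d + 1))%N.
set E := (X in iid_law _ _ X).
have mf : measurable_fun setT (fun z : 'cV[R]_d => sigma (W^T *m z)).
  by apply: measurableT_comp => //; exact: measurable_mulmxl.
have mS : measurable_fun setT
    (fun x : n.-tuple 'cV[R]_d => labelled_sample (fun z => sigma (W^T *m z)) x).
  apply/measurable_fun_tnthP => i.
  have -> : @tnth n _ ^~ i \o labelled_sample (fun z => sigma (W^T *m z)) =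
      (fun z => (z, sigma (W^T *m z))) \o (@tnth n 'cV[R]_d ^~ i).
    by apply/funext => x /=; rewrite tnth_map.
  apply: measurableT_comp; last exact: measurable_tnth.
  by apply: measurable_fun_pair => //; exact: measurable_id.
have mE : measurable E.
  apply: measurable_op_norm_le => // v.
  under eq_fun do rewrite add_lfunE opp_lfunE.
  apply: measurable_addmx; last exact: measurable_cst.
  exact: (measurableT_comp (measurable_span_estimate m rd v) mS).
pose A p : set 'cV[R]_d := [set z | affine_piece sigma p (W^T *m z)].
have mA p : measurable (A p).
  apply: measurable_preimageT; first exact: measurable_mulmxl.
  exact: measurable_affine_piece.
pose few p := few_hits R (A p) n m.
have mfew p : p \in s -> measurable (few p) by move=> _; exact: measurable_few_hits.
pose F : set (n.-tuple 'cV[R]_d) := [set x | exists2 p, p \in s & few p x].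
have mF : measurable F by exact: measurable_exists_seq.
pose G : set (n.-tuple 'cV[R]_d) := @degenerate_sample R _ _ _ (@homog R d) n.
have mG : measurable G.
  by apply: measurable_degenerate_sample; exact: measurable_homog.
have G0 : iid_law (gaussian R d) n G = 0%E.
  apply: degenerate_sample_null; first exact: measurable_homog.
  exact: gaussian_homog_hyperplane0.
have EFG : ~` E `<=` F `|` G.
  move=> x nE; apply: contrapT => nFG; apply: nE; rewrite /E/=.
  rewrite (span_estimate_recovers cover spans WW).
  - by rewrite /subspace_dist subrr; apply/op_norm_leP => // v;
      rewrite lfunE/= (eqP (_ : euclid_norm 0 == 0)) ?euclid_norm_eq0// mulr_ge0 ?euclid_norm_ge0.
  - move=> I DI; apply/eqP => detI; apply: nFG; right; exists I => //.
    by rewrite mem_filter DI mem_enum.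
  - move=> p ps; rewrite leqNgt; apply/negP => h; apply: nFG; left; exists p => //.
    rewrite /few /few_hits/= (_ : \sum_(i < n) _ = #|piece_sample sigma W x p|%:R) ?ltr_nat//.
    rewrite -sum1_card natr_sum [RHS]big_mkcond/=; apply: eq_bigr => i _.
    by rewrite indicE inE; case: asboolP => h'; [rewrite mem_set|rewrite memNset].
have Fb : (iid_law (gaussian R d) n F <=
    ((size s)%:R * (2 ^+ m * (1 - q / 2) ^+ n))%:E)%E.
  apply: le_trans (measure_exists_seq_le (iid_law (gaussian R d) n) mfew) _.
  apply: (@le_trans _ _ (\sum_(p <- s) (2 ^+ m * (1 - q / 2) ^+ n)%:E)%E); last first.
    by rewrite sumEFin big_const_seq count_predT iter_addr_0 mulr_natl.
  rewrite big_seq [leRHS]big_seq; apply: lee_sum => p ps.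
  have [qp qqp gp] := hq p ps.
  have gA : gaussian R d (A p) = qp%:E.
    by rewrite -gp gaussian_orthonormal//; exact: measurable_affine_piece.
  have qp1 : qp <= 1 by rewrite -lee_fin -gA probability_le1.
  apply: le_trans (iid_law_few_hits (mA p) n m gA) _.
  rewrite lee_fin ler_wpM2l ?exprn_ge0// lerXn2r ?nnegrE//; lra.
have : (iid_law (gaussian R d) n (~` E) <=
    ((size s)%:R * (2 ^+ m * (1 - q / 2) ^+ n))%:E)%E.
  apply: le_trans Fb.
  apply: (@le_trans _ _ (iid_law (gaussian R d) n (F `|` G))).
    by apply: le_measure; rewrite ?inE//; [exact: measurableC|exact: measurableU].
  by rewrite measureU0.
rewrite probability_setC// EFinB.
move=> h; rewrite leeBlDr//.
by rewrite addeC -leeBlDr// fin_num_measure.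
Qed.

End success_probability.

Theorem corollary2 (R : realType) :
  exists c : R, 0 < c /\
  forall (r : nat) (sigma : 'cV[R]_r -> R),
    scalar_relu_network sigma ->
    full_intrinsic_dimension sigma ->
  exists C : R, 0 < C /\
  forall (d : nat) (eps : R) (n : nat),
    (r <= d)%N -> 0 < eps <= 1 -> C * d%:R / eps ^+ 2 <= n%:R ->
  exists Shat : n.-tuple ('cV[R]_d * R) -> {vspace 'cV[R]_d},
    subspace_estimator r Shat /\
    forall W : 'M[R]_(d, r), W^T *m W = 1%:M ->
      ((1 - expR (- (d%:R `^ c)))%:E <=
       iid_law (gaussian R d) n
         [set x | (subspace_dist
                     (Shat (labelled_sample (fun z => sigma (W^T *m z)) x))
                     (col_span W) <= eps)%R])%E.
Proof.
exists 1; split => // r sigma net full.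
have [s [q [q0 cover spans hq]]] := relu_active_spanning_pieces net full.
have msigma := measurable_scalar_relu net.
have q1 : q <= 1.
  have [p ps _] := cover 0; have [qp qqp gp] := hq p ps.
  rewrite (le_trans qqp)// -lee_fin -gp probability_le1//.
  exact: measurable_affine_piece.
pose K := size s.
exists (2 * (3 * K%:R + 1) / q); split.
  by rewrite divr_gt0// mulr_gt0// ltr_wpDl// mulr_ge0.
move=> d eps n rd /andP[eps0 eps1] nC.
exists (span_estimate r (K * (d + 1))); split; first exact: span_estimate_estimator.
move=> W WW; have q01 : 0 < q <= 1 by rewrite q0 q1.
(* For [d = 0] the claimed lower bound is 1 - exp(0) = 0. *)
have [d0|d0] := posnP d.
  rewrite (_ : 1 - _ = 0) ?measure_ge0//.
  by rewrite powRr1// d0 oppr0 expR0 subrr.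
apply: le_trans (span_estimate_success n msigma q01 (ltW eps0) cover spans hq rd WW).
rewrite lee_fin powRr1// lerD2l lerN2; apply: few_hits_exp => //.
apply: le_trans nC; rewrite ler_pdivlMr ?exprn_gt0// ler_piMr//.
  by rewrite mulr_ge0// divr_ge0 ?ltW// mulr_gt0// ltr_wpDl// mulr_ge0.
by rewrite exprn_ile1// ltW.
Qed.
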